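(* Let $k$ be a field of characteristic zero. The Virasoro algebra $\mathrm{Vir}$ and the Lie algebras of Cartan type $\mathbf W_n$, $\mathbf S_n$ ($n\ge1$), $\mathbf H_{2m}$ and $\mathbf K_{2m+1}$ ($m\ge1$) over $k$ are well-covered.
   Context: **Well-covered.** $(A,B)$ denotes the span of brackets. An $\mathbb N$-filtered Lie algebra $L$ (subspaces $L=L_0\supset L_1\supset\cdots$ of finite codimension, $(L_i,L_j)\subset L_{i+j}$, $\bigcap L_i=0$) is well-covered if for each $n$ there exists some $f(n)$ such that $L_{f(n)}=(L_i,L_{f(n)-i})$ for $n+1$ values of $i<f(n)/2$. A $\mathbb Z$-graded Lie algebra $L=\bigoplus_{n\in\mathbb Z}L(n)$ is $\mathbb Z$-filtered by $L_j=\bigoplus_{n\ge j}L(n)$; a $\mathbb Z$-filtered Lie algebra is called well-covered if its positive part $L_0$, with the filtration $(L_j)_{j\ge0}$, is well-covered. **Virasoro algebra.** $\mathrm{Vir}$ has basis $d_j$ ($j\in\mathbb Z$), $c$, with $c$ central and $[d_i,d_j]=(i-j)d_{i+j}+(i^3-i)\delta_{i,-j}c$; $d_j$ has degree $j$ and $c$ degree $0$. **Cartan type.** Let $R=k[X_1,\dots,X_n]$, $D_i=\partial/\partial X_i$, and $\mathbf W_n=RD_1+\dots+RD_n$ the Lie algebra of derivations of $R$, acting on the algebra of Kähler differential forms on $R$. $\mathbf S_n=\{\sum a_jD_j:\sum_jD_j(a_j)=0\}$ is the subalgebra annihilating $dX_1\wedge\dots\wedge dX_n$. For $n=2m$, $\mathbf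 H_{2m}$ is the subalgebra annihilating $\omega=\sum_{1\le i\le m}dX_i\wedge dX_{m+i}$. For $n=2m+1$, $\mathbf K_{2m+1}$ is the subalgebra of derivations $\partial$ with $\partial\cdot\alpha=f\alpha$ for some $f\in R$, where $\alpha=dX_{2m+1}+\sum_{1\le i\le m}(X_idX_{m+i}-X_{m+i}dX_i)$. $\mathbf W_n,\mathbf S_n,\mathbf H_{2m}$ carry the $\mathbb Z$-grading induced by the usual grading of $R$ (a homogeneous derivation has degree $j$ if it raises polynomial degree by $j$); $\mathbf K_{2m+1}$ carries the grading induced by the grading of $R$ with $X_1,\dots,X_{2m}$ of degree $1$ and $X_{2m+1}$ of degree $2$. *)

(* Defs.v *)
From HB Require Import structures.
From mathcomp Require Import all_boot all_order all_algebra.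
From mathcomp Require Import ring zify.
From mathcomp.multinomials Require Import freeg mpoly.

Set Implicit Arguments.
Unset Strict Implicit.
Unset Printing Implicit Defensive.

Import GRing.Theory.
Local Open Scope ring_scope.

HB.mixin Record Lmodule_isLie (k : fieldType) V of GRing.Lmodule k V := {
  lie : V -> V -> V;
  lie_linearl : forall (c : k) (x y z : V),
    lie (c *: x + y) z = c *: lie x z + lie y z;
  lie_linearr : forall (c : k) (x y z : V),
    lie x (c *: y + z) = c *: lie x y + lie x z;
  lie_alt : forall x : V, lie x x = 0;
  lie_jacobi : forall x y z : V,
    lie x (lie y z) + lie y (lie z x) + lie z (lie x y) = 0
}.

#[short(type="lieType")]
HB.structure Definition Lie (k : fieldType) :=
  { V of GRing.Lmodule k V & Lmodule_isLie k V }.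

Section WellCovered.
Variables (k : fieldType) (L : lieType k).
Implicit Types (A B P : L -> Prop) (x y z : L).

Definition lin_span P x : Prop :=
  exists (r : nat) (c : 'I_r -> k) (v : 'I_r -> L),
    (forall i, P (v i)) /\ x = \sum_(i < r) c i *: v i.

Definition subspace A : Prop :=
  A 0 /\ forall (c : k) x y, A x -> A y -> A (c *: x + y).

Definition lie_span A B : L -> Prop :=
  lin_span (fun z => exists x y, [/\ A x, B y & z = lie x y]).

Definition finite_codim B A : Prop :=
  exists s : seq L, forall x, A x ->
    exists2 y, B y & lin_span (fun z => z \in s) (x - y).

(* The filtered Lie algebra is [F 0], realized inside the ambient [L]; it is
   closed under brackets by the fourth clause. *)
Definition filtered_lie (F : nat -> L -> Prop) : Prop :=
  [/\ forall i, subspace (F i),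
      forall i x, F i.+1 x -> F i x,
      forall i, finite_codim (F i) (F 0%N),
      forall i j x, lie_span (F i) (F j) x -> F (i + j)%N x
    & forall x, (forall i, F i x) -> x = 0].

Definition well_covered (F : nat -> L -> Prop) : Prop :=
  filtered_lie F /\
  forall n : nat, exists (f : nat) (s : seq nat),
    [/\ uniq s, size s = n.+1
      & forall i, i \in s ->
          (2 * i < f)%N /\ forall x, F f x <-> lie_span (F i) (F (f - i)%N) x].

(* [A] is the internal direct sum of the [G n]; this and the last clause make
   [A] a Lie subalgebra of [L]. *)
Definition zgraded_lie A (G : int -> L -> Prop) : Prop :=
  [/\ forall n, subspace (G n),
      forall x, A x <-> lin_span (fun y => exists n, G n y) x,
      forall (s : seq int) (v : int -> L), uniq s -> (forall n, G n (v n)) ->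
        \sum_(n <- s) v n = 0 -> forall n, n \in s -> v n = 0
    & forall i j x y, G i x -> G j y -> G (i + j) (lie x y)].

Definition zfiltration (G : int -> L -> Prop) (j : int) : L -> Prop :=
  lin_span (fun x => exists2 n : int, (j <= n)%R & G n x).

Definition zgraded_well_covered A (G : int -> L -> Prop) : Prop :=
  zgraded_lie A G /\ well_covered (fun j : nat => zfiltration G j%:Z).

Definition restrict_grading A (G : int -> L -> Prop) (n : int) x : Prop :=
  A x /\ G n x.

End WellCovered.

(* The free module on [option int]: [Some j] stands for d_j, [None] for c. *)
Definition Vir (k : fieldType) : Type := {freeg (option int) / k}.

Section Virasoro.
Variable k : fieldType.

HB.instance Definition _ := GRing.Lmodule.on (Vir k).

Definition vir_d (j : int) : Vir k := << Some j >>.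
Definition vir_c : Vir k := << None >>.

Definition vir_basis_lie (u v : option int) : Vir k :=
  match u, v with
  | Some i, Some j =>
      (i - j)%:~R *: vir_d (i + j)
      + (if i == - j then (i ^+ 3 - i)%:~R *: vir_c else 0)
  | _, _ => 0
  end.

Definition vir_lie (x y : Vir k) : Vir k :=
  fglift (fun u => fglift (fun v => vir_basis_lie u v) y) x.

Definition vir_deg (u : option int) : int := if u is Some j then j else 0.

Definition vir_homog (n : int) (x : Vir k) : Prop :=
  forall u, u \in dom x -> vir_deg u = n.

Lemma fglift_sub (M : lmodType k) (f : option int -> M)
    (x y : {freeg (option int) / k}) :
  fglift f (x - y) = fglift f x - fglift f y.
Proof. exact: lift_is_additive. Qed.

Lemma fglift0 (M : lmodType k) (f : option int -> M) : fglift f 0 = 0.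
Proof. by rewrite -(subrr 0) fglift_sub subrr. Qed.

Lemma fglift_linear (M : lmodType k) (f : option int -> M) (c : k)
    (x y : {freeg (option int) / k}) :
  fglift f (c *: x + y) = c *: fglift f x + fglift f y.
Proof.
have addf (a b : {freeg (option int) / k}) :
  fglift f (a + b) = fglift f a + fglift f b.
  have fN d : fglift f (- d) = - fglift f d by rewrite -sub0r fglift_sub fglift0 sub0r.
  by rewrite -{1}[b]opprK fglift_sub fN opprK.
rewrite addf; congr (_ + _).
elim/freeg_ind_dom0: x => [|e u D _ _ IH].
  by rewrite scaler0 fglift0 scaler0.
have Zu : c *: << e *g u >> = << c * e *g u >> :> {freeg (option int) / k}.
  by apply/eqP/freeg_eqP => v; rewrite coeffZ !coeffU mulrA.
by rewrite scalerDr !addf IH Zu !liftU scalerDr scalerA.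
Qed.

Lemma vir_linearl (c : k) (x y z : Vir k) :
  vir_lie (c *: x + y) z = c *: vir_lie x z + vir_lie y z.
Proof. exact: fglift_linear. Qed.

Lemma vir_linearr (c : k) (x y z : Vir k) :
  vir_lie x (c *: y + z) = c *: vir_lie x y + vir_lie x z.
Proof.
have E w : vir_lie x w = fglift (fun u => fglift (vir_basis_lie u) w) x by [].
rewrite !E; elim/freeg_ind_dom0: x {E} => [|e u D _ _ IH].
  by rewrite !fglift0 scaler0 addr0.
have addf (M : lmodType k) (f : option int -> M) (a b : {freeg (option int) / k}) :
    fglift f (a + b) = fglift f a + fglift f b.
  by rewrite -[a]scale1r fglift_linear !scale1r.
rewrite !addf IH !liftU fglift_linear !scalerDr !scalerA (mulrC e).
by rewrite addrACA.
Qed.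

Lemma vir_ind (P : Vir k -> Prop) :
  (forall u : option int, P (<< u >> : {freeg (option int) / k})) ->
  (forall c x y, P x -> P y -> P (c *: x + y)) -> forall x, P x.
Proof.
move=> PU PL; have P0 : P 0.
  have := PL (-1) _ _ (PU None) (PU None).
  by rewrite scaleN1r addNr.
elim/freeg_ind_dom0 => [//|c u D _ _ IH].
suff -> : << c *g u >> = c *: << u >> :> {freeg (option int) / k} by apply: PL.
by apply/eqP/freeg_eqP => v; rewrite coeffZ !coeffU mul1r.
Qed.

Lemma vir_lieU (u v : option int) :
  vir_lie << u >> << v >> = vir_basis_lie u v.
Proof. by rewrite /vir_lie !liftU !scale1r. Qed.

Lemma vir_basisC u v : vir_basis_lie u v = - vir_basis_lie v u.
Proof.
case: u v => [i|] [j|] /=; rewrite ?oppr0 //.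
rewrite opprD -scaleNr -rmorphN /= opprB addrC (addrC j) [RHS]addrC.
rewrite -(eqr_opp i) opprK (eq_sym _ j); case: eqP => [->|_]; last by rewrite oppr0.
congr (_ + _); rewrite -scaleNr -rmorphN /=; congr (_%:~R *: _); ring.
Qed.

Lemma vir_lieC x y : vir_lie x y = - vir_lie y x.
Proof.
elim/vir_ind: x => [u|c x1 x2 IH1 IH2].
  elim/vir_ind: y => [v|c y1 y2 IH1 IH2]; first by rewrite !vir_lieU vir_basisC.
  by rewrite vir_linearr vir_linearl IH1 IH2 scalerN opprD.
by rewrite vir_linearr vir_linearl IH1 IH2 scalerN opprD.
Qed.

Lemma vir_alt x : vir_lie x x = 0.
Proof.
elim/vir_ind: x => [u|c x y IHx IHy].
  rewrite vir_lieU; case: u => [i|] //=; rewrite subrr scale0r add0r.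
  case: eqP => // iN; have -> : i = 0 by move: iN; lia.
  by rewrite expr0n subrr scale0r.
rewrite vir_linearl !vir_linearr IHx IHy scaler0 add0r addr0 (vir_lieC y x).
by rewrite scalerN subrr.
Qed.

Lemma vir_jacobi x y z :
  vir_lie x (vir_lie y z) + vir_lie y (vir_lie z x) + vir_lie z (vir_lie x y) = 0.
Proof.
pose J x y z := vir_lie x (vir_lie y z) + vir_lie y (vir_lie z x)
  + vir_lie z (vir_lie x y).
have cyc a b c : J a b c = J b c a by rewrite /J -addrA addrC.
have lin c a a' b d : J (c *: a + a') b d = c *: J a b d + J a' b d.
  rewrite /J !(vir_linearl, vir_linearr) !scalerDr.
  by rewrite [RHS]addrACA [X in _ = X + _]addrACA.
rewrite -/(J x y z).
elim/vir_ind: x => [u|c x x' IH IH']; last by rewrite lin IH IH' scaler0 addr0.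
rewrite cyc; elim/vir_ind: y => [v|c y y' IH IH'];
  last by rewrite lin IH IH' scaler0 addr0.
rewrite cyc; elim/vir_ind: z => [w|c z z' IH IH'];
  last by rewrite lin IH IH' scaler0 addr0.
have lie0 a : vir_lie a 0 = 0.
  by have := vir_linearr (-1) a 0 0; rewrite !scaleN1r !addNr.
have liec a : vir_lie a << None >> = 0.
  elim/vir_ind: a => [[i|]|c a a' IH IH']; rewrite ?vir_lieU //.
  by rewrite vir_linearl IH IH' scaler0 addr0.
have ddd i j l : vir_lie << Some i >> (vir_lie << Some j >> << Some l >>)
   = ((j - l) * (i - (j + l)))%:~R *: vir_d (i + j + l)
     + (if i + j + l == 0 then ((j - l) * (i ^+ 3 - i))%:~R *: vir_c else 0).
  rewrite vir_lieU /=.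
  have -> a b e : vir_lie a (e *: vir_d (j + l) + b) = 
     e *: vir_lie a (vir_d (j + l)) + vir_lie a b by exact: vir_linearr.
  have -> : vir_lie << Some i >> (if j == - l then (j ^+ 3 - j)%:~R *: vir_c else 0) = 0.
    case: ifP => // _; rewrite -[_ *: vir_c]addr0 vir_linearr lie0 addr0.
    by rewrite liec scaler0.
  rewrite addr0 /vir_d vir_lieU /= scalerDr scalerA -rmorphM /= addrA.
  have -> : (i == - (j + l)) = (i + j + l == 0) by apply/eqP/eqP; lia.
  congr (_ + _); case: ifP => _; last by rewrite scaler0.
  by rewrite scalerA -rmorphM.
have clie a : vir_lie << None >> a = 0 by rewrite vir_lieC liec oppr0.
rewrite /J; case: u v w => [i|] [j|] [l|];
  try by rewrite ?(clie, liec, lie0) ?vir_lieU /= ?(clie, liec, lie0) !addr0.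
rewrite !ddd.
have -> : l + i + j = i + j + l by ring.
have -> : j + l + i = i + j + l by ring.
rewrite [X in X + _ = _]addrACA [LHS]addrACA -!scalerDl -!rmorphD /=.
case: eqP => [E|_].
  rewrite -!scalerDl -!rmorphD /=.
  have -> : l = - i - j by move: E; lia.
  set a := (X in X%:~R *: vir_d _); set b := (X in X%:~R *: vir_c).
  have -> : a = 0 by rewrite /a; ring.
  have -> : b = 0 by rewrite /b; ring.
  by rewrite !scale0r addr0.
set a := (X in X%:~R *: vir_d _).
have -> : a = 0 by rewrite /a; ring.
by rewrite scale0r !addr0.
Qed.

End Virasoro.

HB.instance Definition _ (k : fieldType) := Lmodule_isLie.Build k (Vir k)
  (@vir_linearl k) (@vir_linearr k) (@vir_alt k) (@vir_jacobi k).

(* The derivation a_1 D_1 + ... + a_n D_n of k[X_1, ..., X_n] is encoded by its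
   coefficients; see [der_lie] and [derivationE]. *)
Definition W (k : fieldType) (n : nat) : Type := {ffun 'I_n -> {mpoly k[n]}}.

Section Derivations.
Variables (k : fieldType) (n : nat).
Implicit Types (a b c : W k n) (p q : {mpoly k[n]}).

HB.instance Definition _ := GRing.Lmodule.on (W k n).

Definition der a p : {mpoly k[n]} := \sum_(j < n) a j * p^`M(j).

Definition W_lie a b : W k n := [ffun j => der a (b j) - der b (a j)].

Lemma der_linear a (t : k) p q : der a (t *: p + q) = t *: der a p + der a q.
Proof.
rewrite /der scaler_sumr -big_split; apply: eq_bigr => j _ /=.
by rewrite mderivD mderivZ mulrDr scalerAr.
Qed.

Lemma derM a p q : der a (p * q) = der a p * q + p * der a q.
Proof.
rewrite /der mulr_suml mulr_sumr -big_split; apply: eq_bigr => j _ /=.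
by rewrite mderivM; ring.
Qed.

Lemma derX a i : der a 'X_i = a i.
Proof.
rewrite /der (bigD1 i) //= big1 => [|j ji]; rewrite mderivX mnm1E.
  have -> : (U_(i) - U_(i) = 0)%MM by apply/mnmP=> l; rewrite mnmBE subnn mnmE.
  by rewrite eqxx scale1r mpolyX0 mulr1 addr0.
by rewrite eq_sym (negPf ji) scale0r mulr0.
Qed.

Lemma der_sumr a (I : Type) (r : seq I) (F : I -> {mpoly k[n]}) :
  der a (\sum_(i <- r) F i) = \sum_(i <- r) der a (F i).
Proof.
rewrite /der exchange_big; apply: eq_bigr => j _ /=.
by rewrite raddf_sum mulr_sumr.
Qed.

Lemma der_lie a b p : der (W_lie a b) p = der a (der b p) - der b (der a p).
Proof.
have E c d : der c (der d p) =
    \sum_(j < n) der c (d j) * p^`M(j)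
    + \sum_(j < n) \sum_(i < n) d j * c i * p^`M(j)^`M(i).
  rewrite {2}/der der_sumr -big_split; apply: eq_bigr => j _ /=.
  rewrite derM; congr (_ + _); rewrite /der mulr_sumr.
  by apply: eq_bigr => i _; rewrite mulrA.
rewrite !E [X in _ = _ - (_ + X)]exchange_big /=.
set S := \sum_(j < n) \sum_(i < n) _; set T := \sum_(j < n) \sum_(i < n) _.
have -> : T = S.
  apply: eq_bigr => j _; apply: eq_bigr => i _.
  by rewrite mderiv_comm [X in X * _]mulrC.
rewrite opprD addrACA subrr addr0 /der -sumrN -big_split.
by apply: eq_bigr => j _; rewrite ffunE mulrBl.
Qed.

Lemma derivationE (D : {mpoly k[n]} -> {mpoly k[n]}) :
    (forall (t : k) p q, D (t *: p + q) = t *: D p + D q) ->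
    (forall p q, D (p * q) = D p * q + p * D q) ->
  D =1 der [ffun j => D 'X_j].
Proof.
move=> Dlin DM; set a := [ffun j => _].
have D1 : D 1 = 0.
  have := DM 1 1; rewrite !mulr1 mul1r => /eqP.
  by rewrite -subr_eq0 opprD addrA subrr sub0r oppr_eq0 => /eqP.
have D0 : D 0 = 0 by have := Dlin (-1) 0 0; rewrite !scaleN1r !addNr.
have der1 : der a 1 = 0 by rewrite /der big1 // => j _; rewrite mderivC mulr0.
have der0 : der a 0 = 0 by rewrite /der big1 // => j _; rewrite mderiv0 mulr0.
elim/mpolyind => [|t m p _ _ IH]; first by rewrite D0 der0.
rewrite Dlin der_linear IH; congr (_ *: _ + _).
rewrite mpolyXE_id; apply: (big_ind (fun p => D p = der a p)) => [|p1 p2 E1 E2|i _].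
- by rewrite D1 der1.
- by rewrite DM derM E1 E2.
elim: (m i) => [|e IHe]; first by rewrite expr0 D1 der1.
by rewrite exprS DM derM IHe derX ffunE.
Qed.

Lemma der_subr a p q : der a (p - q) = der a p - der a q.
Proof. by rewrite addrC -scaleN1r der_linear scaleN1r addrC. Qed.

Lemma der_linearl (t : k) a b p : der (t *: a + b) p = t *: der a p + der b p.
Proof.
rewrite /der scaler_sumr -big_split; apply: eq_bigr => j _ /=.
by rewrite !ffunE mulrDl scalerAl.
Qed.

Lemma W_linearl (t : k) a b c :
  W_lie (t *: a + b) c = t *: W_lie a c + W_lie b c.
Proof.
apply/ffunP=> j; rewrite !ffunE der_linearl der_linear scalerBr.
by rewrite opprD addrACA.
Qed.

Lemma W_linearr (t : k) a b c :
  W_lie a (t *: b + c) = t *: W_lie a b + W_lie a c.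
Proof.
apply/ffunP=> j; rewrite !ffunE der_linearl der_linear scalerBr.
by rewrite opprD addrACA.
Qed.

Lemma W_alt a : W_lie a a = 0.
Proof. by apply/ffunP=> j; rewrite !ffunE subrr. Qed.

Lemma W_jacobi a b c :
  W_lie a (W_lie b c) + W_lie b (W_lie c a) + W_lie c (W_lie a b) = 0.
Proof. by apply/ffunP=> j; rewrite !ffunE !der_lie !der_subr; ring. Qed.

End Derivations.

HB.instance Definition _ (k : fieldType) (n : nat) := Lmodule_isLie.Build k
  (W k n) (@W_linearl k n) (@W_linearr k n) (@W_alt k n) (@W_jacobi k n).

Section Grading.
Variables (k : fieldType) (n : nat) (wt : 'I_n -> nat).

(* Homogeneous polynomials when each X_i is given the degree [wt i]. *)
Definition poly_homog (d : int) (p : {mpoly k[n]}) : Prop :=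
  forall m : 'X_{1..n}, m \in msupp p -> (\sum_(i < n) wt i * m i)%N%:Z = d.

Definition W_homog (j : int) (a : W k n) : Prop :=
  forall (d : nat) (p : {mpoly k[n]}),
    poly_homog d%:Z p -> poly_homog (d%:Z + j) (der a p).

End Grading.

(* The algebra of differential forms on k[X_1, ..., X_n]: the coefficient at
   I = {i_1 < ... < i_p} is that of dX_(i_1) /\ ... /\ dX_(i_p). *)
Definition diff_form (k : fieldType) (n : nat) : Type :=
  {ffun {set 'I_n} -> {mpoly k[n]}}.

Section Forms.
Variables (k : fieldType) (n : nat).
Implicit Types (w u v : diff_form k n) (I J K : {set 'I_n}).

HB.instance Definition _ := GRing.Zmodule.on (diff_form k n).

(* The sign sorting the concatenation of two increasing sequences. *)
Definition wedge_sign I J : {mpoly k[n]} :=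
  (-1) ^+ #|[set ij : 'I_n * 'I_n |
              [&& ij.1 \in I, ij.2 \in J & (ij.2 < ij.1)%N]]|.

Definition wedge u v : diff_form k n :=
  [ffun K : {set 'I_n} => \sum_(I : {set 'I_n} | I \subset K)
               wedge_sign I (K :\: I) * u I * v (K :\: I)].

Definition form0 (f : {mpoly k[n]}) : diff_form k n :=
  [ffun I : {set 'I_n} => if I == set0 then f else 0].

Definition dX (i : 'I_n) : diff_form k n :=
  [ffun I : {set 'I_n} => (I == [set i])%:R].

Definition dform0 (f : {mpoly k[n]}) : diff_form k n :=
  \sum_(i < n) wedge (form0 f^`M(i)) (dX i).

(* The derivation of the algebra of forms that extends [der a] and commutes
   with the exterior derivative, expanded by the Leibniz rule on each
   f dX_(i_1) /\ ... /\ dX_(i_p). *)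
Definition form_act (a : W k n) (w : diff_form k n) : diff_form k n :=
  \sum_(I : {set 'I_n})
    (wedge (form0 (der a (w I))) (\big[wedge/form0 1]_(i <- enum I) dX i)
     + \sum_(s in I) wedge (form0 (w I))
         (\big[wedge/form0 1]_(i <- enum I)
            (if i == s then dform0 (der a 'X_s) else dX i))).

End Forms.

Section CartanType.
Variable k : fieldType.

Definition S_mem (n : nat) (a : W k n) : Prop :=
  \sum_(j < n) (a j)^`M(j) = 0.

Definition H_form (m : nat) : diff_form k (m + m) :=
  \sum_(i < m) wedge (dX k (lshift m i)) (dX k (rshift m i)).

Definition H_mem (m : nat) (a : W k (m + m)) : Prop :=
  form_act a (H_form m) = 0.

Definition K_form (m : nat) : diff_form k (m + m + 1) :=
  let x (i : 'I_m) : 'I_(m + m + 1) := lshift 1 (lshift m i) in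
  let y (i : 'I_m) : 'I_(m + m + 1) := lshift 1 (rshift m i) in
  dX k (rshift (m + m) ord0)
  + \sum_(i < m) (wedge (form0 'X_(x i)) (dX k (y i))
                  - wedge (form0 'X_(y i)) (dX k (x i))).

Definition K_mem (m : nat) (a : W k (m + m + 1)) : Prop :=
  exists f : {mpoly k[m + m + 1]}, form_act a (K_form m) = wedge (form0 f) (K_form m).

Definition std_wt (n : nat) (i : 'I_n) : nat := 1.

Definition K_wt (m : nat) (i : 'I_(m + m + 1)) : nat :=
  if i == rshift (m + m) ord0 then 2 else 1.

End CartanType.

(* Main.v *)
From HB Require Import structures.
From mathcomp Require Import all_boot all_order all_algebra.
From mathcomp Require Import ring zify.
From mathcomp.multinomials Require Import freeg mpoly.
Require Import Defs.

(** Each of these algebras is spanned by homogeneous elements, finitely many in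
    each degree, so the filtration axioms are formal and being well-covered
    reduces to a statement about generators ([graded_span_well_covered]): for
    every [N] there are [f] and [N + 1] values [i < f / 2] such that each
    generator of degree [d >= f] is a combination of brackets of homogeneous
    elements of degrees [i] and [d - i]. In fact a single bracket nearly always
    suffices, with a scalar that must be seen not to vanish in characteristic
    zero.

    For the Virasoro algebra, [[d_i, d_(j-i)] = (2 i - j) d_j] when [j > 0].

    In the Cartan types the generators are indexed by monomials. A monomial of
    large degree has a variable [X_p] with a large exponent, and the bracket
    with a field built from a power of [X_p] alone recovers the generator from
    one of lower degree: [X_p^(i+1) D_p] for general fields ([monW_lie]),
    [X_p^(i+1) D_l] with [l] different from [p] for divergence-free fields
    ([curl_lie]), and the field with potential [X_p^(i+2)] for Hamiltonian
    fields ([ham_lie]). For contact fields the last choice also works when [X_p]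
    is not the contact variable [t], after an induction on the exponent of [t]
    ([contact_bracket_x]); powers of [t] take care of the remaining monomials
    ([contact_bracket_t]), which restricts [i] to even values.

    Knowing the generators requires a description of each subalgebra by
    potentials. Divergence-free fields are sums of plane Hamiltonian fields and
    constants ([S_span]); the fields that annihilate the symplectic form are
    Hamiltonian because closed polynomial 1-forms are exact ([closed_exact],
    [H_mem_ham]); and the fields that multiply the contact form by a function
    are determined by their pairing with it ([K_mem_contact]). *)

Set Implicit Arguments.
Unset Strict Implicit.
Unset Printing Implicit Defensive.

Import GRing.Theory.
Local Open Scope ring_scope.

(** * Graded Lie algebras spanned by homogeneous elements *)

Section Span.
Variables (k : fieldType) (L : lieType k).
Implicit Types (P Q : L -> Prop) (x y z : L).

Lemma subspaceD P x y : subspace P -> P x -> P y -> P (x + y).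
Proof. by move=> [_ PD] Px Py; rewrite -[x]scale1r; apply: PD. Qed.

Lemma subspaceZ P c x : subspace P -> P x -> P (c *: x).
Proof. by move=> [P0 PD] Px; rewrite -[_ *: x]addr0; apply: PD. Qed.

Lemma subspaceN P x : subspace P -> P x -> P (- x).
Proof. by move=> sP Px; rewrite -scaleN1r; apply: subspaceZ. Qed.

Lemma subspaceB P x y : subspace P -> P x -> P y -> P (x - y).
Proof. by move=> sP Px Py; apply: subspaceD => //; apply: subspaceN. Qed.

Lemma subspace_sum P (I : Type) (r : seq I) (C : pred I) (F : I -> L) :
  subspace P -> (forall i, C i -> P (F i)) -> P (\sum_(i <- r | C i) F i).
Proof.
move=> sP PF; apply: big_ind => //; first by case: sP.
by move=> x y; apply: subspaceD.
Qed.

Lemma lin_span_gen P x : P x -> lin_span P x.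
Proof.
move=> Px; exists 1%N, (fun=> 1), (fun=> x); split=> //.
by rewrite big_ord1 scale1r.
Qed.

Lemma lin_span_subspace P : subspace (lin_span P).
Proof.
split.
  by exists 0%N, (fun=> 0), (fun=> 0); split; [case | rewrite big_ord0].
move=> a x y [r [c [v [Pv ->]]]] [s [d [w [Pw ->]]]].
exists (r + s)%N,
  (fun i => match split i with inl j => a * c j | inr j => d j end),
  (fun i => match split i with inl j => v j | inr j => w j end); split.
  by move=> i; case: (split i).
rewrite big_split_ord scaler_sumr /=; congr (_ + _); apply: eq_bigr => i _.
  by rewrite (unsplitK (inl i)) scalerA.
by rewrite (unsplitK (inr i)).
Qed.

Lemma lin_span_min P Q x :
  subspace Q -> (forall y, P y -> Q y) -> lin_span P x -> Q x.
Proof.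
move=> sQ PQ [r [c [v [Pv ->]]]]; apply: subspace_sum => // i _.
by apply: subspaceZ => //; apply: PQ.
Qed.

Lemma lin_span_mono P Q x :
  (forall y, P y -> Q y) -> lin_span P x -> lin_span Q x.
Proof.
move=> PQ; apply: lin_span_min; first exact: lin_span_subspace.
by move=> y Py; apply: lin_span_gen; apply: PQ.
Qed.

Lemma lie_span_mono P P' Q Q' x :
  (forall y, P y -> P' y) -> (forall y, Q y -> Q' y) ->
  lie_span P Q x -> lie_span P' Q' x.
Proof.
move=> PP QQ; apply: lin_span_mono => _ [y [z [Py Qz ->]]].
by exists y, z; split; auto.
Qed.

Lemma lie_span_gen P Q x y : P x -> Q y -> lie_span P Q (lie x y).
Proof. by move=> Px Qy; apply: lin_span_gen; exists x, y. Qed.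

Lemma lie_span_scaled P Q (c : k) x y z :
  c != 0 -> P x -> Q y -> lie x y = c *: z -> lie_span P Q z.
Proof.
move=> c0 Px Qy E; rewrite -[z]scale1r -(mulVf c0) -scalerA -E.
by apply: subspaceZ; [apply: lin_span_subspace | apply: lie_span_gen].
Qed.

Lemma lie0l x : lie 0 x = 0.
Proof. by have := lie_linearl (-1) 0 0 x; rewrite !scaleN1r !addNr. Qed.

Lemma lie0r x : lie x 0 = 0.
Proof. by have := lie_linearr (-1) x 0 0; rewrite !scaleN1r !addNr. Qed.

Lemma subspace_lie_preiml Q y : subspace Q -> subspace (fun x => Q (lie x y)).
Proof.
move=> [Q0 QD]; split=> [|c x z Qx Qz]; first by rewrite lie0l.
by rewrite lie_linearl; apply: QD.
Qed.

Lemma subspace_lie_preimr Q x : subspace Q -> subspace (fun y => Q (lie x y)).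
Proof.
move=> [Q0 QD]; split=> [|c y z Qy Qz]; first by rewrite lie0r.
by rewrite lie_linearr; apply: QD.
Qed.

Lemma homogeneous_decomposition (H : int -> L -> Prop) (D : int -> Prop) x :
    (forall n, subspace (H n)) ->
    lin_span (fun y => exists2 n, D n & H n y) x ->
  exists (s : seq int) (v : int -> L),
    [/\ uniq s, forall n, n \in s -> D n, forall n, H n (v n),
        forall n, n \notin s -> v n = 0 & x = \sum_(n <- s) v n].
Proof.
move=> sH [r [c [y [/fin_all_exists2 [d Dd Hd] ->]]]].
exists (undup [seq d i | i : 'I_r]).
exists (fun n => \sum_(i < r | d i == n) c i *: y i); split.
- exact: undup_uniq.
- by move=> n; rewrite mem_undup => /mapP [i _ ->].
- by move=> n; apply: subspace_sum => // i /eqP <-; apply: subspaceZ.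
- move=> n; rewrite mem_undup => nd; rewrite big1 // => i /eqP di.
  by case/negP: nd; rewrite -di; apply: map_f; rewrite mem_enum.
rewrite (exchange_big_dep xpredT) //=; apply: eq_bigr => i _.
rewrite (big_rem (d i)) /=; last first.
  by rewrite mem_undup; apply: map_f; rewrite mem_enum.
rewrite eqxx big_seq_cond big1 ?addr0 // => n /andP [].
rewrite mem_rem_uniq ?undup_uniq // inE => /andP [ni _] /eqP E.
by rewrite E eqxx in ni.
Qed.

Definition independent (G : int -> L -> Prop) : Prop :=
  forall (s : seq int) (v : int -> L), uniq s -> (forall n, G n (v n)) ->
    \sum_(n <- s) v n = 0 -> forall n, n \in s -> v n = 0.

(** Group a combination of generators by degree and compare it with [x]:
    independence kills the terms of degree other than [n]. *)
Lemma homogeneous_span (B : Type) (e : B -> L) (deg : B -> int)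
    (G : int -> L -> Prop) n x :
    (forall n, subspace (G n)) -> independent G ->
    (forall b, G (deg b) (e b)) ->
    lin_span (fun y => exists b, y = e b) x -> G n x ->
  lin_span (fun y => exists2 b, deg b = n & y = e b) x.
Proof.
move=> sG indG Ge xe Gx.
pose H j := lin_span (fun y => exists2 b, deg b = j & y = e b).
have HG j y : H j y -> G j y.
  by apply: lin_span_min => // _ [b <- ->].
have [|s [v [us _ Hv v0 E]]] :=
  @homogeneous_decomposition H (fun=> True) x (fun=> lin_span_subspace _).
  apply: lin_span_mono xe => _ [b ->]; exists (deg b) => //.
  by apply: lin_span_gen; exists b.
pose w j := v j - (if j == n then x else 0).
have Gw j : G j (w j).
  apply: subspaceB => //; first exact: HG.
  by case: eqP => [->|_] //; case: (sG j).
have uns : uniq (undup (n :: s)) by exact: undup_uniq.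
have nns : n \in undup (n :: s) by rewrite mem_undup mem_head.
have w0 : \sum_(j <- undup (n :: s)) w j = 0.
  have ns1 : [seq j <- undup (n :: s) | j == n] = [:: n].
    exact: filter_pred1_uniq.
  rewrite sumrB -big_mkcond -[X in _ - X]big_filter ns1 big_seq1 E /=.
  case: ifP => ns; first by rewrite undup_id // subrr.
  by rewrite undup_id // big_cons v0 ?ns // add0r subrr.
have /eqP := indG _ _ uns Gw w0 _ nns.
by rewrite /w eqxx subr_eq0 => /eqP <-; apply: Hv.
Qed.

End Span.

Section GradedSpan.
Variables (k : fieldType) (L : lieType k).
Variables (A : L -> Prop) (G : int -> L -> Prop).
Variables (B : eqType) (e : B -> L) (deg : B -> int) (enumB : nat -> seq B).
Hypothesis sG : forall n, subspace (G n).
Hypothesis indG : independent G.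
Hypothesis lieG : forall i j x y, G i x -> G j y -> G (i + j) (lie x y).
Hypothesis GA : forall n x, G n x -> A x.
Hypothesis Ae : forall x, A x <-> lin_span (fun y => exists b, y = e b) x.
Hypothesis Ge : forall b, G (deg b) (e b).
Hypothesis enumBP : forall b (n : nat), deg b = n%:Z -> b \in enumB n.

Lemma G_span n x :
  G n x -> lin_span (fun y => exists2 b, deg b = n & y = e b) x.
Proof.
by move=> Gx; apply: homogeneous_span (Gx) => //; apply/Ae; apply: GA Gx.
Qed.

Lemma span_zgraded : zgraded_lie A G.
Proof.
split=> // x; split.
  move/Ae; apply: lin_span_mono => _ [b ->]; by exists (deg b).
have sA : subspace A.
  have [s0 sD] := lin_span_subspace (fun y => exists b, y = e b).
  by split=> [|c y z /Ae Ay /Ae Az]; apply/Ae => //; apply: sD.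
by apply: lin_span_min => // y [n]; apply: GA.
Qed.

Lemma zfiltration_subspace j : subspace (zfiltration G j).
Proof. exact: lin_span_subspace. Qed.

Lemma zfiltration_gen (j n : int) x : (j <= n)%R -> G n x -> zfiltration G j x.
Proof. by move=> jn Gx; apply: lin_span_gen; exists n. Qed.

Lemma zfiltration_codim i : finite_codim (zfiltration G i%:Z) (zfiltration G 0).
Proof.
exists (flatten [seq map e (enumB n) | n <- iota 0 i]) => x.
set T := lin_span _.
have sT : subspace T by exact: lin_span_subspace.
have sF := zfiltration_subspace i%:Z.
apply: (@lin_span_min _ _ _
  (fun x => exists2 y, zfiltration G i y & T (x - y))).
  split; first by exists 0; [case: sF | rewrite subrr; case: sT].
  move=> c y z [y' Fy Ty] [z' Fz Tz]; exists (c *: y' + z').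
    by case: sF => _; apply.
  rewrite opprD addrACA -scalerBr; by case: sT => _; apply.
move=> y [n n0 Gy]; have [ni|ni] := boolP (i%:Z <= n)%R.
  exists y; first exact: zfiltration_gen Gy.
  by rewrite subrr; case: sT.
exists 0; first by case: sF.
rewrite subr0; apply: lin_span_min (G_span Gy) => // _ [b bn ->].
apply: lin_span_gen; apply/flattenP; case: n n0 ni bn {Gy} => // n _ ni bn.
exists (map e (enumB n)); last by apply: map_f; apply: enumBP.
by apply: map_f; rewrite mem_iota; lia.
Qed.

(** An element of every [L_j] has a finite decomposition, hence also one in
    degrees beyond all those of the first; independence makes both zero. *)
Lemma zfiltration_sep x : (forall i : nat, zfiltration G i x) -> x = 0.
Proof.
move=> Fx.
have [s [v [us _ Gv v0 E]]] := homogeneous_decomposition sG (Fx 0%N).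
pose N := (\max_(n <- s) `|n|).+1.
have [t [w [ut tN Gw w0 E']]] := homogeneous_decomposition sG (Fx N).
have disj (n : int) : n \in s -> n \notin t.
  move=> ns; apply/negP => /tN.
  have : (absz n < N)%N by rewrite /N ltnS; rewrite (big_rem n) //= leq_maxl.
  lia.
have ust : uniq (s ++ t).
  rewrite cat_uniq us ut andbT; apply/hasPn => n nt; apply/negP => /disj.
  by rewrite nt.
have z0 : \sum_(n <- s ++ t) (v n - w n) = 0.
  rewrite big_cat /= !sumrB -E -E' [\sum_(n <- s) w n]big1_seq; last first.
    by move=> n /andP [_ ns]; apply/w0/disj.
  rewrite [\sum_(n <- t) v n]big1_seq ?subr0 ?sub0r ?subrr // => n /andP [_ nt].
  by apply: v0; apply/negP => /disj; rewrite nt.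
have H n : n \in s -> v n = 0.
  move=> ns; have := indG ust _ z0 _; move/(_ _ n); rewrite mem_cat ns.
  rewrite (w0 n) ?disj // subr0; apply => // j; exact: subspaceB.
by rewrite E big1_seq // => n /= /H.
Qed.

Lemma zfiltration_lie (i j : nat) x :
  lie_span (zfiltration G i) (zfiltration G j) x -> zfiltration G (i + j)%N x.
Proof.
have sF := zfiltration_subspace (i + j)%N.
apply: lin_span_min => // _ [y [z [Fy Fz ->]]].
apply: (lin_span_min (subspace_lie_preiml z sF)) Fy => y' [a ia Gy].
apply: (lin_span_min (subspace_lie_preimr y' sF)) Fz => z' [b jb Gz].
by apply: (zfiltration_gen _ (lieG Gy Gz)); rewrite PoszD; lia.
Qed.

Lemma span_filtered : filtered_lie (fun j : nat => zfiltration G j).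
Proof.
split.
- by move=> i; apply: zfiltration_subspace.
- move=> i x; apply: lin_span_mono => y [n ni Gy]; exists n => //; lia.
- exact: zfiltration_codim.
- exact: zfiltration_lie.
- exact: zfiltration_sep.
Qed.

(** Once the generators [e b] are homogeneous with finitely many in each degree,
    the filtration axioms are formal, and by bilinearity it is enough to cover
    each generator of degree at least [f] by brackets of homogeneous elements
    of degrees [i] and [deg b - i]. *)
Lemma graded_span_well_covered :
    (forall n : nat, exists (f : nat) (s : seq nat),
      [/\ uniq s, size s = n.+1 & forall i, i \in s -> (2 * i < f)%N /\
        forall b, (f%:Z <= deg b)%R ->
          lie_span (G i%:Z) (G (deg b - i%:Z)) (e b)]) ->
  zgraded_well_covered A G.
Proof.
move=> cov; split; first exact: span_zgraded.
split; first exact: span_filtered.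
move=> n; have [f [s [us ss sP]]] := cov n; exists f, s.
split=> // i /sP [i2 H].
split=> // x; split; last first.
  by move/zfiltration_lie; rewrite subnKC //; lia.
have sF : subspace (lie_span (zfiltration G i) (zfiltration G (f - i)%N)).
  exact: lin_span_subspace.
apply: lin_span_min => // y [d fd Gy].
apply: (lin_span_min sF) (G_span Gy) => _ [b bd ->].
have fb : (f%:Z <= deg b)%R by rewrite bd.
apply: lie_span_mono (H b fb) => z; first exact: zfiltration_gen.
by apply: zfiltration_gen; lia.
Qed.

End GradedSpan.

(** * The Virasoro algebra *)

Section CharZero.
Variables (k : fieldType) (k0 : [pchar k] =i pred0).

Lemma natr_char0 (n : nat) : (n%:R == 0 :> k) = (n == 0%N).
Proof. exact: (proj1 (pcharf0P k) k0). Qed.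

Lemma intr_char0 (z : int) : (z%:~R == 0 :> k) = (z == 0).
Proof.
case: z => n; first by rewrite -pmulrn natr_char0.
by rewrite NegzE mulrNz oppr_eq0 -pmulrn natr_char0 oppr_eq0.
Qed.

End CharZero.

Section VirasoroWC.
Variables (k : fieldType) (k0 : [pchar k] =i pred0).

Let e (u : option int) : Vir k := << u >>.

Lemma vir_homogE n (x : Vir k) :
  vir_homog n x <-> (forall u, vir_deg u != n -> coeff u x = 0).
Proof.
split=> H u; first by move=> un; apply/coeff_outdom/negP => /H; apply/eqP.
rewrite mem_dom => ux; apply/eqP; apply: contraNT ux => /H ->.
by rewrite eqxx.
Qed.

Lemma vir_homog_subspace n : subspace (@vir_homog k n).
Proof.
split=> [|c x y /vir_homogE x0 /vir_homogE y0]; apply/vir_homogE => u un.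
  by rewrite coeff0.
by rewrite coeffD coeffZ x0 // y0 // mulr0 addr0.
Qed.

Lemma vir_homog_gen u : vir_homog (vir_deg u) (e u).
Proof.
apply/vir_homogE => v; rewrite coeffU mul1r.
by have [->|] := eqVneq u v; rewrite ?eqxx.
Qed.

Lemma vir_homog_independent : independent (L := Vir k) (@vir_homog k).
Proof.
move=> s v us Gv sv n ns; apply/eqP/freeg_eqP => u; rewrite coeff0.
have [un|/(proj1 (vir_homogE _ _) (Gv n)) //] := eqVneq (vir_deg u) n.
have := congr1 (coeff u) sv; rewrite coeff0 raddf_sum /= (big_rem n) //=.
rewrite big1_seq ?addr0 // => j /=; rewrite mem_rem_uniq // inE => /andP [jn _].
by apply: (proj1 (vir_homogE _ _) (Gv j)); rewrite un eq_sym.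
Qed.

Lemma vir_span (x : Vir k) : lin_span (fun y => exists u, y = e u) x.
Proof.
elim/vir_ind: x => [u|c x y IHx IHy]; first by apply: lin_span_gen; exists u.
have [_ PD] := lin_span_subspace (L := Vir k) (fun y => exists u, y = e u).
exact: PD.
Qed.

Lemma vir_homog_span n (x : Vir k) :
  vir_homog n x -> lin_span (fun y => exists2 u, vir_deg u = n & y = e u) x.
Proof.
apply: homogeneous_span; first exact: vir_homog_subspace.
- exact: vir_homog_independent.
- exact: vir_homog_gen.
- exact: vir_span.
Qed.

Lemma vir_lieE u v : lie (e u) (e v) = vir_basis_lie k u v.
Proof. exact: vir_lieU. Qed.

Lemma vir_homog_lie i j (x y : Vir k) :
  vir_homog i x -> vir_homog j y -> vir_homog (i + j) (lie x y).
Proof.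
move=> /vir_homog_span xi /vir_homog_span yj.
have sG := vir_homog_subspace (i + j).
apply: (lin_span_min (subspace_lie_preiml y sG)) xi => _ [u ui ->].
apply: (lin_span_min (subspace_lie_preimr (e u) sG)) yj => _ [v vj ->].
rewrite vir_lieE -ui -vj; case: u v {sG ui vj} => [a|] [b|] /=;
  try by move=> u; rewrite dom0.
have sG := vir_homog_subspace (a + b).
apply: (@subspaceD _ (Vir k) _ _ _ sG).
  apply: (@subspaceZ _ (Vir k) _ _ _ sG).
  exact: (@vir_homog_gen (Some (a + b))).
case: eqP => [->|_]; last by case: sG.
apply: (@subspaceZ _ (Vir k) _ _ _ (vir_homog_subspace _)).
by rewrite addNr; exact: (@vir_homog_gen None).
Qed.

(** For [i < j - i] the bracket of [d_i] and [d_(j - i)] is a nonzero multiple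
    of [d_j], and the cocycle vanishes because [j] is positive. *)
Lemma vir_well_covered :
  zgraded_well_covered (L := Vir k) (fun=> True) (@vir_homog k).
Proof.
apply: (@graded_span_well_covered _ (Vir k) _ _ _ e vir_deg
  (fun n => [:: None; Some n%:Z])) => //.
- exact: vir_homog_subspace.
- exact: vir_homog_independent.
- exact: vir_homog_lie.
- by move=> x; split=> // _; apply: vir_span.
- exact: vir_homog_gen.
- by move=> [j|] n //= ->; rewrite !inE eqxx.
move=> n; exists (2 * n).+3, (iota 0 n.+1); split.
- exact: iota_uniq.
- exact: size_iota.
move=> i; rewrite mem_iota => /andP [_ i_n]; split; first lia.
move=> [j|] //= fj.
have cN0 : (i%:Z - (j - i%:Z))%:~R != 0 :> k by rewrite intr_char0 //; lia.
apply: (lie_span_scaled (x := e (Some i%:Z)) (y := e (Some (j - i%:Z))) cN0).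
- exact: (@vir_homog_gen (Some _)).
- exact: (@vir_homog_gen (Some _)).
by rewrite vir_lieE /= subrKC; case: eqP => [|_]; [lia | rewrite addr0].
Qed.

End VirasoroWC.

(** * Polynomial vector fields and their gradings *)

Section Derivations.
Variables (k : fieldType) (n : nat).
Implicit Types (a : W k n) (p q : {mpoly k[n]}) (m : 'X_{1..n}) (i j : 'I_n).

Lemma derD a p q : der a (p + q) = der a p + der a q.
Proof. by rewrite -[p]scale1r der_linear !scale1r. Qed.

Lemma der0 a : der a 0 = 0.
Proof. by rewrite /der big1 // => j _; rewrite mderiv0 mulr0. Qed.

Lemma der1 a : der a 1 = 0.
Proof. by rewrite /der big1 // => j _; rewrite mderivC mulr0. Qed.

Lemma derZ a (t : k) p : der a (t *: p) = t *: der a p.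
Proof. by rewrite -[t *: p]addr0 der_linear der0 addr0. Qed.

Lemma mderiv_sum i (I : Type) (r : seq I) (C : pred I) (F : I -> {mpoly k[n]}) :
  (\sum_(j <- r | C j) F j)^`M(i) = \sum_(j <- r | C j) (F j)^`M(i).
Proof. exact: raddf_sum. Qed.

Lemma mderiv_der a p i :
  (der a p)^`M(i) = der a p^`M(i) + \sum_(j < n) (a j)^`M(i) * p^`M(j).
Proof.
rewrite /der mderiv_sum -big_split /=; apply: eq_bigr => j _.
by rewrite mderivM addrC mderiv_comm.
Qed.

Lemma mderivXU m i :
  ('X_[m + U_(i)] : {mpoly k[n]})^`M(i) = (m i).+1%:R *: 'X_[m].
Proof.
rewrite mderivX mnmDE mnm1E eqxx addn1; congr (_ *: 'X_[_]).
by apply/mnmP => j; rewrite mnmBE mnmDE addnK.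
Qed.

Lemma mderiv_pow i e :
  ('X_[U_(i) *+ e.+1] : {mpoly k[n]})^`M(i) = e.+1%:R *: 'X_[U_(i) *+ e].
Proof. by rewrite mulmSr mderivXU mulmnE mnm1E eqxx mul1n. Qed.

Lemma mderiv_pow_neq i j e :
  i != j -> ('X_[U_(i) *+ e] : {mpoly k[n]})^`M(j) = 0.
Proof.
by move=> ij; rewrite mderivX mulmnE mnm1E (negPf ij) mul0n scale0r.
Qed.

Lemma mderivXX i j : ('X_i : {mpoly k[n]})^`M(j) = (i == j)%:R.
Proof.
case: eqP => [->|/eqP ij].
  by have := mderiv_pow j 0; rewrite mulm1n mulm0n mpolyX0 scale1r.
by have := mderiv_pow_neq 1 ij; rewrite mulm1n.
Qed.

Lemma mulX_mderivX m i :
  'X_i * ('X_[m] : {mpoly k[n]})^`M(i) = (m i)%:R *: 'X_[m].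
Proof.
rewrite mderivX -scalerAr -mpolyXD.
have [->|mi] := eqVneq (m i) 0%N; first by rewrite !scale0r.
congr (_ *: 'X_[_]); apply/mnmP => s; rewrite mnmDE mnmBE mnm1E.
by case: (i =P s) => [<-|_]; lia.
Qed.

End Derivations.

Section WeightedPolynomials.
Variables (k : fieldType) (n : nat) (wt : 'I_n -> nat).
Implicit Types (m : 'X_{1..n}) (p q : {mpoly k[n]}) (d : int).

Definition wdeg m : nat := (\sum_(i < n) wt i * m i)%N.

Lemma wdegD m m' : wdeg (m + m')%MM = (wdeg m + wdeg m')%N.
Proof.
by rewrite -big_split; apply: eq_bigr => i _; rewrite mnmDE mulnDr.
Qed.

Lemma wdegU i : wdeg U_(i)%MM = wt i.
Proof.
rewrite /wdeg (bigD1 i) //= mnm1E eqxx muln1 big1 ?addn0 // => j ji.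
by rewrite mnm1E eq_sym (negPf ji) muln0.
Qed.

Lemma wdegMn m e : wdeg (m *+ e)%MM = (wdeg m * e)%N.
Proof.
by rewrite /wdeg big_distrl; apply: eq_bigr => i _; rewrite mulmnE mulnA.
Qed.

Lemma wdeg_subU m i c : (c <= m i)%N ->
  (wdeg (m - U_(i) *+ c)%MM + wt i * c)%N = wdeg m.
Proof.
move=> cm; rewrite -wdegU -wdegMn -wdegD submK //; apply/mnm_lepP => j.
by rewrite mulmnE mnm1E; case: (i =P j) => [<-|_]; lia.
Qed.

Lemma mdeg_wdeg m : (forall i, 0 < wt i)%N -> (mdeg m <= wdeg m)%N.
Proof.
by move=> wt0; rewrite mdegE; apply: leq_sum => i _; apply: leq_pmull.
Qed.

Lemma poly_homogP d p :
  poly_homog wt d p <-> (forall m, (wdeg m)%:Z != d -> p@_m = 0).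
Proof.
split=> H m.
  by apply: contraNeq; rewrite -mcoeff_msupp => /H ->.
by rewrite mcoeff_msupp; apply: contraNeq => /H ->.
Qed.

Lemma poly_homog0 d : poly_homog wt d (0 : {mpoly k[n]}).
Proof. by apply/poly_homogP => m _; rewrite mcoeff0. Qed.

Lemma poly_homogD d p q :
  poly_homog wt d p -> poly_homog wt d q -> poly_homog wt d (p + q).
Proof.
move=> /poly_homogP p0 /poly_homogP q0; apply/poly_homogP => m md.
by rewrite mcoeffD p0 // q0 // addr0.
Qed.

Lemma poly_homogZ d (c : k) p : poly_homog wt d p -> poly_homog wt d (c *: p).
Proof.
move=> /poly_homogP p0; apply/poly_homogP => m md.
by rewrite mcoeffZ p0 // mulr0.
Qed.

Lemma poly_homogN d p : poly_homog wt d p -> poly_homog wt d (- p).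
Proof. by move=> pd; rewrite -scaleN1r; apply: poly_homogZ. Qed.

Lemma poly_homog_sum d (I : Type) (r : seq I) (C : pred I)
    (F : I -> {mpoly k[n]}) :
  (forall i, C i -> poly_homog wt d (F i)) ->
  poly_homog wt d (\sum_(i <- r | C i) F i).
Proof.
by move=> Fd; apply: big_ind => //; [apply: poly_homog0 | apply: poly_homogD].
Qed.

Lemma poly_homogM d d' p q :
  poly_homog wt d p -> poly_homog wt d' q -> poly_homog wt (d + d') (p * q).
Proof.
move=> pd qd m /msuppM_le /allpairsP [[a b] [/= ap bq ->]].
by rewrite -/(wdeg _) wdegD PoszD -(pd _ ap) -(qd _ bq).
Qed.

Lemma poly_homogX m : poly_homog wt (wdeg m)%:Z ('X_[m] : {mpoly k[n]}).
Proof. by move=> m'; rewrite msuppX inE => /eqP ->. Qed.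

Lemma poly_homog_deriv d i p :
  poly_homog wt d p -> poly_homog wt (d - (wt i)%:Z) p^`M(i).
Proof.
move=> /poly_homogP p0; apply/poly_homogP => m md.
rewrite mcoeff_deriv p0 ?mul0rn // wdegD wdegU.
by apply: contraNneq md; lia.
Qed.

Lemma poly_homog_neg d p : (d < 0)%R -> poly_homog wt d p -> p = 0.
Proof.
move=> d0 /poly_homogP p0; apply/mpolyP => m; rewrite mcoeff0 p0 //.
by apply/eqP; lia.
Qed.

(** Evaluate on the variables for one direction; the other holds because
    [D_i] lowers the weight by [wt i]. *)
Lemma W_homogP d (a : W k n) :
  W_homog wt d a <-> (forall i, poly_homog wt ((wt i)%:Z + d) (a i)).
Proof.
split=> H i.
  by rewrite -derX; apply: H; rewrite -(wdegU i); apply: poly_homogX.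
move=> p pi; apply: poly_homog_sum => j _.
have -> : i%:Z + d = (wt j)%:Z + d + (i%:Z - (wt j)%:Z) by lia.
by apply: poly_homogM => //; apply: poly_homog_deriv.
Qed.

Lemma W_homog_subspace d : subspace (L := W k n) (W_homog wt d).
Proof.
split=> [|c a b /W_homogP ad /W_homogP bd]; apply/W_homogP => i.
  by rewrite ffunE; apply: poly_homog0.
by rewrite !ffunE; apply: poly_homogD => //; apply: poly_homogZ.
Qed.

Lemma W_homog_independent : independent (L := W k n) (W_homog wt).
Proof.
move=> s v us Gv sv d ds; apply/ffunP => i; apply/mpolyP => m.
rewrite ffunE mcoeff0.
have [mi|/(proj1 (poly_homogP _ _) (proj1 (W_homogP _ _) (Gv d) i)) //] :=
  eqVneq (wdeg m)%:Z ((wt i)%:Z + d).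
have : (\sum_(j <- s) v j : W k n) i = 0 by rewrite sv ffunE.
rewrite sum_ffunE => /(congr1 (mcoeff m)); rewrite raddf_sum /= (big_rem d) //=.
rewrite mcoeff0 big1_seq ?addr0 // => j /=.
rewrite mem_rem_uniq // inE => /andP [jd _].
apply: (proj1 (poly_homogP _ _) (proj1 (W_homogP _ _) (Gv j) i)).
by rewrite mi; apply: contraNneq jd; lia.
Qed.

Lemma W_homog_lie d d' (a b : W k n) :
  W_homog wt d a -> W_homog wt d' b -> W_homog wt (d + d') (lie a b).
Proof.
have der_homog e e' (f : W k n) p : W_homog wt e f -> poly_homog wt e' p ->
    poly_homog wt (e' + e) (der f p).
  move=> fe; case: e' => [e'|e'] pe; first exact: fe.
  by rewrite (poly_homog_neg _ pe) // der0; apply: poly_homog0.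
move=> ad bd; have /W_homogP ai := ad; have /W_homogP bi := bd.
apply/W_homogP => i; rewrite ffunE; apply: poly_homogD.
  have -> : (wt i)%:Z + (d + d') = (wt i)%:Z + d' + d by lia.
  exact: der_homog.
apply: poly_homogN; rewrite addrA; exact: der_homog.
Qed.

End WeightedPolynomials.

Section Monomials.
Variables (k : fieldType) (n : nat).
Implicit Types (m : 'X_{1..n}) (p q : {mpoly k[n]}).

Definition monomials (d : nat) : seq 'X_{1..n} :=
  [seq bmnm b | b <- enum {: 'X_{1..n < d.+1}}].

Lemma mem_monomials m d : (mdeg m <= d)%N -> m \in monomials d.
Proof.
rewrite -ltnS => md; apply/mapP; exists (BMultinom md) => //.
by rewrite mem_enum.
Qed.

Lemma exists_large_exponent m c : (n * c < mdeg m)%N -> exists i, (c < m i)%N.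
Proof.
move=> H; apply/existsP; apply: contraTT H => /existsPn H.
rewrite -leqNgt mdegE mulnC -[X in (_ <= c * X)%N]card_ord mulnC -sum_nat_const.
by apply: leq_sum => i _; rewrite leqNgt.
Qed.

(** Each algebra below is the image of a linear map from polynomial potentials;
    this is how it is spanned by the images of monomials. *)
Lemma monomial_span (L : lieType k) (Phi : {mpoly k[n]} -> L) (Q : L -> Prop) p :
    (forall c p q, Phi (c *: p + q) = c *: Phi p + Phi q) -> subspace Q ->
    (forall m, m \in msupp p -> Q (Phi 'X_[m])) -> Q (Phi p).
Proof.
move=> PhiL sQ Qm.
have Phi0 : Phi 0 = 0 by have := PhiL (-1) 0 0; rewrite !scaleN1r !addNr.
rewrite [p]mpolyE big_seq; apply: (big_ind (fun q => Q (Phi q))).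
- by rewrite Phi0; case: sQ.
- by move=> q r Qq Qr; rewrite -[q]scale1r PhiL scale1r; apply: subspaceD.
by move=> m /Qm; rewrite -[_ *: _]addr0 PhiL Phi0 addr0; apply: subspaceZ.
Qed.

Lemma lieWE (a b : W k n) : lie a b = W_lie a b. Proof. by []. Qed.

(** The field [p D_i]. *)
Definition vf p (i : 'I_n) : W k n := [ffun j => if j == i then p else 0].

Lemma vf_linear i c p q : vf (c *: p + q) i = c *: vf p i + vf q i.
Proof.
by apply/ffunP => j; rewrite !ffunE; case: eqP; rewrite // scaler0 addr0.
Qed.

Lemma vf0 i : vf 0 i = 0.
Proof. by apply/ffunP => j; rewrite !ffunE; case: eqP. Qed.

Lemma vfZ i c p : vf (c *: p) i = c *: vf p i.
Proof. by rewrite -[c *: p]addr0 vf_linear vf0 addr0. Qed.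

Lemma der_vf p i q : der (vf p i) q = p * q^`M(i).
Proof.
rewrite /der (bigD1 i) //= ffunE eqxx big1 ?addr0 // => j ji.
by rewrite ffunE (negPf ji) mul0r.
Qed.

Lemma W_vf_sum (a : W k n) : a = \sum_(i < n) vf (a i) i.
Proof.
apply/ffunP => j; rewrite sum_ffunE (bigD1 j) //= ffunE eqxx big1 ?addr0 //.
by move=> i ij; rewrite ffunE eq_sym (negPf ij).
Qed.

Lemma lie_vf p q i j :
  lie (vf p i) (vf q j) = vf (p * q^`M(i)) j - vf (q * p^`M(j)) i.
Proof.
apply/ffunP => l; rewrite lieWE !ffunE !der_vf.
by congr (_ - _); case: eqP; rewrite ?mderiv0 ?mulr0.
Qed.

Lemma vf_homog wt (d : int) p i :
  poly_homog wt ((wt i)%:Z + d) p -> W_homog wt d (vf p i).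
Proof.
move=> pd; apply/W_homogP => j; rewrite ffunE.
by case: eqP => [->|_] //; apply: poly_homog0.
Qed.

End Monomials.

Section WSubalgebra.
Variables (k : fieldType) (n : nat) (wt : 'I_n -> nat) (A : W k n -> Prop).
Variables (B : eqType) (e : B -> W k n) (deg : B -> int) (enumB : nat -> seq B).
Hypothesis lieA : forall a b, A a -> A b -> A (lie a b).
Hypothesis Ae : forall x, A x <-> lin_span (fun y => exists b, y = e b) x.
Hypothesis e_homog : forall b, W_homog wt (deg b) (e b).
Hypothesis enumBP : forall b (j : nat), deg b = j%:Z -> b \in enumB j.

Lemma W_subalgebra_well_covered :
    (forall N : nat, exists (f : nat) (s : seq nat),
      [/\ uniq s, size s = N.+1 & forall i, i \in s -> (2 * i < f)%N /\
        forall b, (f%:Z <= deg b)%R ->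
          lie_span (restrict_grading A (W_homog wt) i%:Z)
            (restrict_grading A (W_homog wt) (deg b - i%:Z)) (e b)]) ->
  zgraded_well_covered A (restrict_grading A (W_homog wt)).
Proof.
have [A0 AD] : subspace A.
  have [s0 sD] := lin_span_subspace (fun y => exists b, y = e b).
  by split=> [|c y z /Ae Ay /Ae Az]; apply/Ae => //; apply: sD.
apply: (@graded_span_well_covered _ _ A _ B e deg enumB) => //.
- move=> d; have [W0 WD] := @W_homog_subspace k n wt d.
  by split=> // c x y [Ax Wx] [Ay Wy]; split; [apply: AD | apply: WD].
- move=> s v us Gv; apply: W_homog_independent us _ => d; exact: (Gv d).2.
- by move=> i j x y [Ax Wx] [Ay Wy]; split; [apply: lieA | apply: W_homog_lie].
- by move=> d x [].
- by move=> b; split=> //; apply/Ae; apply: lin_span_gen; exists b.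
Qed.

End WSubalgebra.

(** * General and divergence-free vector fields *)

Section GeneralAndSpecial.
Variables (k : fieldType) (k0 : [pchar k] =i pred0) (n : nat).
Implicit Types (m : 'X_{1..n}) (p q g : {mpoly k[n]}).

Lemma wdeg_std m : wdeg (@std_wt n) m = mdeg m.
Proof. by rewrite mdegE; apply: eq_bigr => i _; rewrite mul1n. Qed.

Lemma mdeg_subU m i c :
  (c <= m i)%N -> mdeg (m - U_(i) *+ c)%MM = (mdeg m - c)%N.
Proof.
move=> /(wdeg_subU (@std_wt n)); rewrite !wdeg_std mul1n; lia.
Qed.

Let monW (b : 'X_{1..n} * 'I_n) : W k n := vf 'X_[b.1] b.2.

Lemma monW_homog m i (d : int) :
  (mdeg m)%:Z = 1 + d -> W_homog (@std_wt n) d (vf ('X_[m] : {mpoly k[n]}) i).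
Proof.
move=> md; apply: vf_homog; rewrite -[(std_wt i)%:Z]/(1 : int) -md -wdeg_std.
exact: poly_homogX.
Qed.

(** In degree [i] the field [X_l^(i+1) D_l] suffices: the scalar produced is
    [m l - i] or [m l - 2 i - 1], hence nonzero once [X_l] has a large exponent,
    and some variable has one when the degree is large. *)
Lemma monW_lie m i (j l : 'I_n) : (i < m l)%N ->
  lie (vf ('X_[U_(l) *+ i.+1] : {mpoly k[n]}) l) (vf 'X_[m - U_(l) *+ i] j) =
  ((m l - i)%:R - (if j == l then i.+1%:R else 0)) *: vf 'X_[m] j.
Proof.
move=> im; rewrite lie_vf.
pose b := (m - U_(l) *+ i.+1)%MM.
have bl : (b l).+1 = (m l - i)%N.
  by rewrite mnmBE mulmnE mnm1E eqxx; lia.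
have -> : (m - U_(l) *+ i = b + U_(l))%MM.
  apply/mnmP => s; rewrite !(mnmDE, mnmBE, mulmnE, mnm1E).
  by case: eqP => [<-|_]; lia.
rewrite mderivXU bl -scalerAr -mpolyXD.
have -> : (U_(l) *+ i.+1 + b = m)%MM.
  apply/mnmP => s; rewrite !(mnmDE, mnmBE, mulmnE, mnm1E).
  by case: eqP => [<-|_]; lia.
case: eqP => [->|/eqP jl]; last first.
  by rewrite mderiv_pow_neq 1?eq_sym // mulr0 vf0 vfZ !subr0.
rewrite mderiv_pow -scalerAr -mpolyXD.
have -> : (b + U_(l) + U_(l) *+ i = m)%MM.
  apply/mnmP => s; rewrite !(mnmDE, mnmBE, mulmnE, mnm1E).
  by case: eqP => [<-|_]; lia.
by rewrite !vfZ scalerBl.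
Qed.

Lemma W_well_covered :
  zgraded_well_covered (L := W k n) (fun=> True) (W_homog (@std_wt n)).
Proof.
apply: (@graded_span_well_covered _ (W k n) _ _ _ monW
  (fun b => (mdeg b.1)%:Z - 1)
  (fun d => [seq (m, i) | m <- monomials n d.+1, i <- enum 'I_n])) => //.
- exact: W_homog_subspace.
- exact: W_homog_independent.
- exact: W_homog_lie.
- move=> a; split=> // _; rewrite [a]W_vf_sum.
  apply: (@subspace_sum _ (W k n)) => [|i _]; first exact: lin_span_subspace.
  apply: (@monomial_span _ _ (W k n) (fun p => vf p i)) => [c p q||m _].
  + exact: vf_linear.
  + exact: lin_span_subspace.
  by apply: lin_span_gen; exists (m, i).
- by move=> [m i]; apply: monW_homog; rewrite subrKC.
- move=> [m i] d /= md; apply/allpairsP; exists (m, i); split=> //=.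
    by apply: mem_monomials; lia.
  by rewrite mem_enum.
(* In degree at least [n * (2 N + 1)] some exponent exceeds [2 N + 1]; the other
   summand gives [2 i < f]. *)
move=> N; exists (n * (2 * N).+1 + (2 * N).+1)%N, (iota 0 N.+1); split.
- exact: iota_uniq.
- exact: size_iota.
move=> i; rewrite mem_iota => /andP [_ iN]; split; first lia.
move=> [m j] /= fm.
have [|l ml] := @exists_large_exponent n m (2 * N).+1; first by move: fm; lia.
apply: (@lie_span_scaled _ (W k n) _ _ _ _ _ _ _ _ _ (@monW_lie m i j l _)).
- case: (j == l); last by rewrite subr0 natr_char0 //; lia.
  by rewrite -natrB ?natr_char0 //; lia.
- by apply: monW_homog; rewrite mdegMn mdeg1; lia.
- by apply: monW_homog; rewrite mdeg_subU; lia.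
- lia.
Qed.

(** The Hamiltonian field of [q] in the plane of [X_l] and [X_j]. *)
Definition curl (l j : 'I_n) q : W k n := vf q^`M(l) j - vf q^`M(j) l.

Lemma curl_linear l j c p q :
  curl l j (c *: p + q) = c *: curl l j p + curl l j q.
Proof.
by rewrite /curl !mderivD !mderivZ !vf_linear scalerBr opprD addrACA.
Qed.

Lemma curlZ l j c q : curl l j (c *: q) = c *: curl l j q.
Proof. by rewrite /curl !mderivZ !vfZ scalerBr. Qed.

Lemma curlC l j q : curl l j q = - curl j l q.
Proof. by rewrite /curl opprB. Qed.

Lemma lie_vf_curl g q l j :
  g^`M(l) = 0 -> lie (vf g l) (curl l j q) = curl l j (g * q^`M(l)).
Proof.
move=> g0; rewrite -[curl l j q]/(vf q^`M(l) j - vf q^`M(j) l).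
rewrite -[X in lie _ X]addrC -scaleN1r lie_linearr scaleN1r !lie_vf g0.
rewrite mulr0 vf0 subr0.
rewrite /curl !mderivM g0 mul0r add0r !(mderiv_comm j l) addrC.
apply/ffunP => s; rewrite !ffunE.
by case: (s == l); case: (s == j); rewrite ?subr0 ?sub0r ?oppr0 ?addr0; ring.
Qed.

Definition divergence (a : W k n) : {mpoly k[n]} := \sum_(j < n) (a j)^`M(j).

Lemma divergence_linear c (a b : W k n) :
  divergence (c *: a + b) = c *: divergence a + divergence b.
Proof.
rewrite scaler_sumr -big_split; apply: eq_bigr => j _ /=.
by rewrite !ffunE mderivD mderivZ.
Qed.

Lemma divergence_vf p i : divergence (vf p i) = p^`M(i).
Proof.
rewrite /divergence (bigD1 i) //= ffunE eqxx big1 ?addr0 // => j ji.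
by rewrite ffunE (negPf ji) mderiv0.
Qed.

Lemma S_subspace : subspace (L := W k n) (@S_mem k n).
Proof.
split=> [|c a b a0 b0].
  by rewrite /S_mem big1 // => j _; rewrite ffunE mderiv0.
rewrite /S_mem [LHS]divergence_linear [divergence a]a0 [divergence b]b0.
by rewrite scaler0 addr0.
Qed.

Lemma S_curl l j q : S_mem (curl l j q).
Proof.
rewrite /S_mem -/(divergence _) /curl addrC -scaleN1r divergence_linear.
by rewrite !divergence_vf mderiv_comm scaleN1r addNr.
Qed.

Lemma S_vf g l : g^`M(l) = 0 -> S_mem (vf g l).
Proof. by move=> g0; rewrite /S_mem -/(divergence _) divergence_vf. Qed.

(** The divergence of [[a, b]] is [a (div b) - b (div a)]: the terms with two
    first derivatives are symmetric in [a] and [b]. *)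
Lemma S_lie (a b : W k n) : S_mem a -> S_mem b -> S_mem (lie a b).
Proof.
have divE (c d : W k n) : \sum_(j < n) (der c (d j))^`M(j)
    = der c (divergence d)
      + \sum_(j < n) \sum_(i < n) (c i)^`M(j) * (d j)^`M(i).
  rewrite /divergence der_sumr -big_split; apply: eq_bigr => j _ /=.
  by rewrite mderiv_der.
rewrite /S_mem -!/(divergence _) => a0 b0; rewrite /divergence.
under eq_bigr do rewrite lieWE ffunE mderivB.
rewrite sumrB !divE a0 b0.
rewrite !der0 !add0r [X in _ - X]exchange_big /=; apply/eqP; rewrite subr_eq0.
apply/eqP; apply: eq_bigr => j _; apply: eq_bigr => i _; exact: mulrC.
Qed.

Lemma mderiv_surj l p : exists q : {mpoly k[n]}, q^`M(l) = p.
Proof.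
elim/mpolyind: p => [|c m p _ _ [q IH]]; first by exists 0; rewrite mderiv0.
exists (c *: (((m l).+1%:R)^-1 *: 'X_[m + U_(l)]) + q).
rewrite mderivD !mderivZ mderivXU IH [_^-1 *: _]scalerA mulVf ?scale1r //.
by rewrite natr_char0.
Qed.

Lemma mderiv_eq0 l p m : p^`M(l) = 0 -> m \in msupp p -> m l = 0%N.
Proof.
move=> p0 mp; apply/eqP; apply: contraTT mp => ml; rewrite mcoeff_msupp negbK.
have /(congr1 (mcoeff (m - U_(l))%MM)) := p0.
rewrite mcoeff0 mcoeff_deriv.
have -> : (m - U_(l) + U_(l) = m)%MM.
  apply/mnmP => j; rewrite mnmDE mnmBE mnm1E.
  by case: (l =P j) => [<-|_]; lia.
by move/eqP; rewrite -mulr_natr mulf_eq0 natr_char0 // orbF.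
Qed.

(** The constant fields are curls when [1 < n]; they are the whole algebra
    when [n = 1]. *)
Let monS (b : 'X_{1..n} * 'I_n * 'I_n + 'I_n) : W k n :=
  match b with
  | inl (m, l, j) => curl l j 'X_[m]
  | inr l => vf 1 l
  end.

Let degS (b : 'X_{1..n} * 'I_n * 'I_n + 'I_n) : int :=
  if b is inl (m, _, _) then (mdeg m)%:Z - 2 else - 1.

Lemma curl_monomial_homog m l j (d : int) : (mdeg m)%:Z = 2 + d ->
  W_homog (@std_wt n) d (curl l j ('X_[m] : {mpoly k[n]})).
Proof.
move=> md.
have H i i' : W_homog (@std_wt n) d (vf ('X_[m] : {mpoly k[n]})^`M(i) i').
  apply: vf_homog; rewrite -[(std_wt i')%:Z]/(1 : int).
  have -> : 1 + d = (wdeg (@std_wt n) m)%:Z - (std_wt i)%:Z.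
    by rewrite wdeg_std md /std_wt; lia.
  by apply: poly_homog_deriv; apply: poly_homogX.
exact: (@subspaceB _ (W k n) (W_homog (@std_wt n) d) _ _
  (W_homog_subspace _ _ _) (H l j) (H j l)).
Qed.

(** Subtracting the curls that integrate the components [a j], [j != l], in the
    variable [X_l] leaves a field [g D_l] with [g] independent of [X_l]; each
    of its monomials is constant or integrable in another variable. *)
Lemma S_span (a : W k n) (l : 'I_n) :
  S_mem a -> lin_span (L := W k n) (fun y => exists b, y = monS b) a.
Proof.
move=> Sa; set P := lin_span _.
have sP : subspace P by exact: lin_span_subspace.
have Pcurl i j q : P (curl i j q).
  apply: (@monomial_span _ _ (W k n) (curl i j)) => // [c p r|m _].
    exact: curl_linear.
  by apply: lin_span_gen; exists (inl (m, i, j)).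
have Pvf g : g^`M(l) = 0 -> P (vf g l).
  move=> g0.
  apply: (@monomial_span _ _ (W k n) (fun p => vf p l) P g) => // [c p q|m].
    exact: vf_linear.
  move=> /(mderiv_eq0 g0) ml.
  have [->|/eqP mN0] := eqVneq m 0%MM.
    by rewrite mpolyX0; apply: lin_span_gen; exists (inr l).
  have [i mi] : exists i, m i != 0%N.
    apply/existsP; apply: contra_notT mN0 => /existsPn m0.
    by apply/mnmP => i; rewrite mnm0E; apply/eqP; have := m0 i; rewrite negbK.
  have il : i != l by apply: contraNneq mi => ->; rewrite ml.
  have := Pcurl i l 'X_[m + U_(i)].
  rewrite /curl mderivXU mderivX mnmDE ml mnm1E (negPf il) scale0r.
  move/(subspaceZ ((m i).+1%:R)^-1 sP).
  by rewrite vf0 subr0 vfZ scalerA mulVf ?scale1r // natr_char0.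
have [q qP] : exists q : 'I_n -> {mpoly k[n]}, forall j, (q j)^`M(l) = a j.
  exact: (fin_all_exists (fun j => mderiv_surj l (a j))).
pose b := \sum_(j < n | j != l) curl l j (q j).
have Pb : P b by apply: (@subspace_sum _ (W k n) _ _ _ _ _ sP) => j _.
pose g := (a - b) l.
have E : a - b = vf g l.
  apply/ffunP => j; rewrite [RHS]ffunE; case: eqP => [->//|/eqP jl].
  rewrite !ffunE sum_ffunE (bigD1 j) //= big1 => [|i /andP [il ij]].
    by rewrite !ffunE eqxx (negPf jl) qP !(addr0, subr0, oppr0) subrr.
  by rewrite !ffunE eq_sym (negPf ij) (negPf jl) subr0.
have Sb : S_mem b.
  apply: (@subspace_sum _ (W k n) _ _ _ _ _ S_subspace) => j _.
  exact: S_curl.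
have Sab : S_mem (a - b) by exact: (@subspaceB _ (W k n) _ _ _ S_subspace).
rewrite -(subrK b a); apply: (@subspaceD _ (W k n) _ _ _ sP) => //; rewrite E.
apply: Pvf.
by rewrite -divergence_vf -E.
Qed.

(** As [p] differs from [l], the field [X_p^(i+1) D_l] is divergence-free, and
    its bracket acts on the potential as [X_p^(i+1) D_l]; integrating in [X_l]
    makes the scalar positive. *)
Lemma curl_lie m i (l j p : 'I_n) : p != l -> (i < m p)%N ->
  lie (vf ('X_[U_(p) *+ i.+1] : {mpoly k[n]}) l)
    (curl l j 'X_[m - U_(p) *+ i.+1 + U_(l)]) = (m l).+1%:R *: curl l j 'X_[m].
Proof.
move=> pl mi; rewrite lie_vf_curl ?mderiv_pow_neq // mderivXU.
have -> : ((m - U_(p) *+ i.+1)%MM l).+1 = (m l).+1.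
  by rewrite mnmBE mulmnE mnm1E (negPf pl) subn0.
rewrite -scalerAr -mpolyXD.
have -> : (U_(p) *+ i.+1 + (m - U_(p) *+ i.+1) = m)%MM.
  apply/mnmP => s; rewrite !(mnmDE, mnmBE, mulmnE, mnm1E).
  by case: eqP => [<-|_]; lia.
exact: curlZ.
Qed.

Lemma S_well_covered : (0 < n)%N ->
  zgraded_well_covered (@S_mem k n)
    (restrict_grading (@S_mem k n) (W_homog (@std_wt n))).
Proof.
move=> n0; pose l0 := Ordinal n0.
apply: (@W_subalgebra_well_covered _ _ _ _ _ monS degS (fun d =>
  [seq inl (mi, j) | mi <- [seq (m, i) | m <- monomials n d.+2, i <- enum 'I_n],
     j <- enum 'I_n])).
- exact: S_lie.
- move=> a; split; first exact: (S_span l0).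
  apply: (@lin_span_min _ (W k n)) => [|_ [[[[m l] j]|l] ->]].
  + exact: S_subspace.
  + exact: S_curl.
  by apply: S_vf; rewrite mderivC.
- move=> [[[m l] j]|l]; first by apply: curl_monomial_homog => /=; lia.
  by rewrite /= -mpolyX0; apply: monW_homog; rewrite mdeg0.
- move=> [[[m l] j]|l] // d /= md; apply/allpairsP; exists ((m, l), j).
  split=> //=; last by rewrite mem_enum.
  apply/allpairsP; exists (m, l); split=> //=; last by rewrite mem_enum.
  by apply: mem_monomials; lia.
move=> N; exists (n * N.+1 + (2 * N).+1)%N, (iota 0 N.+1); split.
- exact: iota_uniq.
- exact: size_iota.
move=> i; rewrite mem_iota => /andP [_ iN]; split; first lia.
move=> [[[m l] j]|l] /=; last by lia.
set d := _ - 2 => fm; set P := lie_span _ _.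
have sP : subspace P by exact: lin_span_subspace.
have md : (mdeg m)%:Z = 2 + d by rewrite /d; lia.
clearbody d.
have main (l' j' p : 'I_n) : p != l' -> (i < m p)%N ->
    P (curl l' j' ('X_[m] : {mpoly k[n]})).
  move=> pl mi.
  apply: (@lie_span_scaled _ (W k n) _ _ _ _ _ _ _ _ _ (curl_lie j' pl mi)).
  - by rewrite natr_char0.
  - split; first by apply: S_vf; rewrite mderiv_pow_neq.
    by apply: monW_homog; rewrite mdegMn mdeg1; lia.
  split; first exact: S_curl.
  have := mdeg_subU mi; have : (m p <= mdeg m)%N.
    by rewrite mdegE (bigD1 p) //= leq_addr.
  by move=> mp E; apply: curl_monomial_homog; rewrite mdegD mdeg1 E; lia.
have [|p mp] := @exists_large_exponent n m N.+1; first by move: fm; lia.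
have [pl|pl] := eqVneq p l; last by apply: (main l j p) => //; lia.
have [jl|jl] := eqVneq j l; first by rewrite jl /curl subrr; case: sP.
rewrite curlC; apply: (@subspaceN _ (W k n) _ _ sP).
by apply: (main j l p); [rewrite pl eq_sym | lia].
Qed.

End GeneralAndSpecial.

(** * Lie derivatives of low-degree differential forms *)

Section Forms.
Variables (k : fieldType) (n : nat).
Implicit Types (u v w : diff_form k n) (I J K : {set 'I_n}) (a : W k n).
Implicit Types (f : {mpoly k[n]}) (c : 'I_n -> {mpoly k[n]}).

Lemma wedge_sign0l J : wedge_sign k set0 J = 1.
Proof.
rewrite /wedge_sign (_ : [set ij | _] = set0) ?cards0 //.
by apply/setP => ij; rewrite !inE.
Qed.

Lemma wedge_sign0r I : wedge_sign k I set0 = 1.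
Proof.
rewrite /wedge_sign (_ : [set ij | _] = set0) ?cards0 //.
by apply/setP => ij; rewrite !inE andbF.
Qed.

Lemma wedge_sign11 (i j : 'I_n) :
  wedge_sign k [set i] [set j] = (-1) ^+ (j < i)%N.
Proof.
rewrite /wedge_sign; congr (_ ^+ _).
rewrite (_ : [set ij | _] = if (j < i)%N then [set (i, j)] else set0).
  by case: ifP => _; rewrite ?cards1 ?cards0.
apply/setP => [[x y]]; rewrite !inE /=.
case: eqP => [->|xi] /=; last by case: ifP; rewrite !inE // xpair_eqE; case: eqP.
by case: eqP => [->|yj]; case: ifP; rewrite !inE // xpair_eqE ?eqxx //; case: eqP.
Qed.

Lemma wedge_form0l f v : wedge (form0 f) v = [ffun K => f * v K].
Proof.
apply/ffunP => K; rewrite !ffunE (bigD1 set0) ?sub0set //= ffunE eqxx setD0.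
rewrite wedge_sign0l mul1r big1 ?addr0 // => I /andP [_ I0].
by rewrite ffunE (negPf I0) mulr0 mul0r.
Qed.

Lemma wedge_form1l v : wedge (form0 1) v = v.
Proof. by rewrite wedge_form0l; apply/ffunP => K; rewrite ffunE mul1r. Qed.

Lemma wedge_form1r u : wedge u (form0 1) = u.
Proof.
apply/ffunP => K; rewrite !ffunE (bigD1 K) //= ffunE setDv eqxx wedge_sign0r.
rewrite mul1r mulr1 big1 ?addr0 // => I /andP [IK nIK].
rewrite ffunE setD_eq0; case: ifP => [KI|]; last by rewrite mulr0.
by rewrite eqEsubset IK KI in nIK.
Qed.

Lemma wedge_dX (i j : 'I_n) : wedge (dX k i) (dX k j) =
  [ffun K => if (i != j) && (K == [set i; j]) then (-1) ^+ (j < i)%N else 0].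
Proof.
apply/ffunP => K; rewrite !ffunE big_mkcond (bigD1 [set i]) //= big1; last first.
  by move=> I Ii; rewrite !ffunE (negPf Ii) mulr0 mul0r; case: ifP.
rewrite addr0 !ffunE eqxx mulr1 sub1set.
have [E|E] := eqVneq (K :\: [set i]) [set j]; last first.
  rewrite mulr0 if_same; case: ifP => // /andP [ij /eqP EK].
  case/negP: E; rewrite EK; apply/eqP/setP => s; rewrite !inE.
  by case: eqP => [->|_] //=; rewrite (negPf ij).
have neq_ij : i != j.
  by have := set11 j; rewrite -E !inE eq_sym => /andP [/negPf ->].
rewrite neq_ij mulr1 E wedge_sign11 /=.
have -> // : (K == [set i; j]) = (i \in K).
apply/eqP/idP => [->|iK]; first by rewrite !inE eqxx.
by rewrite -(setD1K iK) E.
Qed.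

Lemma wedge_dXC (i j : 'I_n) :
  wedge (dX k i) (dX k j) = - wedge (dX k j) (dX k i).
Proof.
apply/ffunP => K; rewrite !wedge_dX !ffunE eq_sym setUC.
have [->|ij] := eqVneq i j; first by rewrite oppr0.
case: ifP => _; last by rewrite oppr0.
case: (ltngtP i j) => [_|_|/val_inj E]; rewrite ?expr0 ?expr1 ?opprK //.
by rewrite E eqxx in ij.
Qed.

Lemma wedge_dX_pair (i j p q : 'I_n) : (p < q)%N ->
  wedge (dX k i) (dX k j) [set p; q] =
  ((i == p) && (j == q))%:R - ((i == q) && (j == p))%:R.
Proof.
move=> pq; have npq : p != q by apply: contraTneq pq => ->; rewrite ltnn.
rewrite wedge_dX ffunE.
have [/andP [/eqP -> /eqP ->]|h1] := boolP ((i == p) && (j == q)).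
  by rewrite npq eqxx (negPf npq) subr0 ltnNge ltnW.
have [/andP [/eqP -> /eqP ->]|h2] := boolP ((i == q) && (j == p)).
  by rewrite eq_sym npq setUC eqxx pq expr1 sub0r.
rewrite subrr; case: ifP => // /andP [ij /eqP /setP E].
have := E i; have := E j; rewrite !inE !eqxx orbT /=.
case/orP => /eqP jE /orP [] /eqP iE; move: ij h1 h2; subst i j;
  by rewrite ?eqxx // (negPf npq).
Qed.

Definition oneform c : diff_form k n :=
  \sum_(i < n) wedge (form0 (c i)) (dX k i).

Lemma oneformE c K : oneform c K = \sum_(i < n) c i * (K == [set i])%:R.
Proof.
by rewrite sum_ffunE; apply: eq_bigr => i _; rewrite wedge_form0l !ffunE.
Qed.

Lemma oneform1 c i : oneform c [set i] = c i.
Proof.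
rewrite oneformE (bigD1 i) //= eqxx mulr1 big1 ?addr0 // => j ji.
by rewrite (inj_eq set1_inj) eq_sym (negPf ji) mulr0.
Qed.

Lemma oneform_inj c c' : oneform c = oneform c' <-> c =1 c'.
Proof.
split=> [E i|E]; first by rewrite -oneform1 E oneform1.
by apply: eq_bigr => i _; rewrite E.
Qed.

Lemma wedge_form0_oneform f c :
  wedge (form0 f) (oneform c) = oneform (fun i => f * c i).
Proof.
apply/ffunP => K; rewrite wedge_form0l ffunE !oneformE mulr_sumr.
by apply: eq_bigr => i _; rewrite mulrA.
Qed.

Lemma wedge_oneform_dX c j K :
  wedge (oneform c) (dX k j) K = \sum_(i < n) c i * wedge (dX k i) (dX k j) K.
Proof.
rewrite ffunE; under [RHS]eq_bigr do rewrite ffunE mulr_sumr.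
rewrite exchange_big /=; apply: eq_bigr => I _.
rewrite oneformE mulr_sumr mulr_suml; apply: eq_bigr => i _.
by rewrite [dX k i I]ffunE; ring.
Qed.

Lemma wedge_dX_oneform c j K :
  wedge (dX k j) (oneform c) K = \sum_(i < n) c i * wedge (dX k j) (dX k i) K.
Proof.
rewrite ffunE; under [RHS]eq_bigr do rewrite ffunE mulr_sumr.
rewrite exchange_big /=; apply: eq_bigr => I _.
rewrite oneformE mulr_sumr; apply: eq_bigr => i _.
by rewrite [dX k i (K :\: I)]ffunE; ring.
Qed.

(** The Lie derivative of [f dX_(i_1) ... dX_(i_p)]. It is additive in [f], so
    [form_act] is computed from a decomposition of a form into such terms. *)
Definition act_term a I f : diff_form k n :=
  wedge (form0 (der a f)) (\big[@wedge k n/form0 1]_(i <- enum I) dX k i)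
  + \sum_(s in I) wedge (form0 f) (\big[@wedge k n/form0 1]_(i <- enum I)
      (if i == s then dform0 (der a 'X_s) else dX k i)).

Lemma act_term0 a I : act_term a I 0 = 0.
Proof.
apply/ffunP => K; rewrite /act_term der0 !wedge_form0l !ffunE mul0r add0r.
by rewrite sum_ffunE big1 // => s _; rewrite wedge_form0l ffunE mul0r.
Qed.

Lemma act_termD a I f f' :
  act_term a I (f + f') = act_term a I f + act_term a I f'.
Proof.
apply/ffunP => K; rewrite /act_term derD !wedge_form0l !ffunE !sum_ffunE mulrDl.
rewrite addrACA; congr (_ + _); rewrite -big_split; apply: eq_bigr => s _ /=.
by rewrite !wedge_form0l !ffunE mulrDl.
Qed.

Lemma form_act_supported (T : finType) (J : T -> {set 'I_n})
    (c : T -> {mpoly k[n]}) a w :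
    (forall I, w I = \sum_(t : T) (if I == J t then c t else 0)) ->
  form_act a w = \sum_(t : T) act_term a (J t) (c t).
Proof.
move=> wE; rewrite /form_act -/(act_term a _ _).
transitivity (\sum_I \sum_(t : T) act_term a I (if I == J t then c t else 0)).
  apply: eq_bigr => I _; rewrite -/(act_term a I (w I)) wE.
  exact: (big_morph _ (act_termD a I) (act_term0 a I)).
rewrite exchange_big /=; apply: eq_bigr => t _.
rewrite (bigD1 (J t)) //= eqxx big1 ?addr0 // => I /negPf ->.
exact: act_term0.
Qed.

Lemma form_act_oneform a c : form_act a (oneform c) =
  oneform (fun p => der a (c p) + \sum_(q < n) c q * (a q)^`M(p)).
Proof.
rewrite (@form_act_supported _ (fun i => [set i]) c); last first.
  move=> I; rewrite oneformE; apply: eq_bigr => i _.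
  by case: ifP => _; rewrite ?mulr1 ?mulr0.
apply/ffunP => K; rewrite sum_ffunE oneformE.
under eq_bigr do rewrite /act_term big_set1 enum_set1 !big_cons !big_nil
  !wedge_form1r eqxx derX !wedge_form0l !ffunE.
rewrite big_split /= [RHS](eq_bigr (fun i => der a (c i) * (K == [set i])%:R
  + \sum_(q < n) c q * (a q)^`M(i) * (K == [set i])%:R)); last first.
  by move=> i _ /=; rewrite mulrDl [X in _ + X = _]mulr_suml.
rewrite [RHS]big_split /= [X in _ = _ + X]exchange_big /=; congr (_ + _).
apply: eq_bigr => q _; rewrite -/(oneform _) oneformE mulr_sumr.
by apply: eq_bigr => i _; rewrite mulrA.
Qed.

Lemma enum_set2 (i j : 'I_n) : (i < j)%N -> enum [set i; j] = [:: i; j].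
Proof.
move=> ij; pose r := [rel x y : 'I_n | (x < y)%N].
have rt : transitive r by move=> y x z; apply: ltn_trans.
apply: (irr_sorted_eq rt) => [x||| x]; rewrite /= ?ltnn ?ij //.
  have -> : enum [set i; j] = [seq x <- enum 'I_n | x \in [set i; j]].
    by rewrite enumT.
  apply: sorted_filter => //.
  by have := iota_ltn_sorted 0 n; rewrite -val_enum_ord sorted_map.
by rewrite mem_enum !inE.
Qed.

Lemma act_term_pair a (i j : 'I_n) : (i < j)%N ->
  act_term a [set i; j] 1 =
  wedge (dform0 (a i)) (dX k j) + wedge (dX k i) (dform0 (a j)).
Proof.
move=> ij; have nij : i != j by apply: contraTneq ij => ->; rewrite ltnn.
have form0l (v : diff_form k n) : wedge (form0 0) v = 0.
  by rewrite wedge_form0l; apply/ffunP => K; rewrite !ffunE mul0r.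
have sum2 (F : 'I_n -> diff_form k n) : \sum_(s in [set i; j]) F s = F i + F j.
  by rewrite big_setU1 ?inE // big_set1.
rewrite /act_term der1 form0l add0r sum2 enum_set2 //.
have nji : (j == i) = false by rewrite eq_sym (negPf nij).
congr (_ + _); rewrite [LHS]wedge_form1l !big_cons !big_nil !eqxx ?nji
  ?(negPf nij) derX.
  by rewrite [wedge (dX k j) _]wedge_form1r.
by rewrite [wedge (dform0 _) _]wedge_form1r.
Qed.

End Forms.

(** * Hamiltonian vector fields *)

Section Poincare.
Variables (k : fieldType) (k0 : [pchar k] =i pred0) (n : nat).
Implicit Types (m : 'X_{1..n}) (p q g : {mpoly k[n]}).

Lemma mcoeff_euler p m :
  (\sum_(i < n) 'X_i * p^`M(i))@_m = (mdeg m)%:R * p@_m.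
Proof.
elim/mpolyind: p => [|c m' p _ _ IH].
  rewrite big1 ?mcoeff0 ?mulr0 // => i _; by rewrite mderiv0 mulr0.
under eq_bigr do rewrite mderivD mderivZ mulrDr -scalerAr mulX_mderivX.
rewrite big_split /= mcoeffD IH -scaler_sumr -scaler_suml -natr_sum -mdegE.
rewrite mcoeffD !mcoeffZ mcoeffX mulrDr; congr (_ + _).
by case: eqP => [->|_]; rewrite ?mulr0 // !mulr1 mulrC.
Qed.

(** Contract the closed 1-form with the Euler field and divide the degree [d]
    part of the result by [d]. *)
Lemma closed_exact (b : 'I_n -> {mpoly k[n]}) :
  (forall i j, (b j)^`M(i) = (b i)^`M(j)) -> exists u, forall i, u^`M(i) = b i.
Proof.
move=> clb; pose g := \sum_(j < n) 'X_j * b j.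
have divE h : exists u : {mpoly k[n]},
    forall m, mdeg m != 0%N -> (mdeg m)%:R * u@_m = h@_m.
  elim/mpolyind: h => [|c m' p _ _ [u uP]].
    by exists 0 => m _; rewrite !mcoeff0 mulr0.
  exists ((c / (mdeg m')%:R) *: 'X_[m'] + u) => m m0.
  rewrite !mcoeffD !mcoeffZ mulrDr uP // mcoeffX; congr (_ + _).
  case: eqP => [->|_]; rewrite ?mulr0 // !mulr1 mulrC divfK //.
  by rewrite natr_char0.
have [u uP] := divE g; exists u => i; apply/mpolyP => m.
have md : mdeg (m + U_(i))%MM = (mdeg m).+1 by rewrite mdegD mdeg1 addn1.
have c0 : (mdeg m).+1%:R != 0 :> k by rewrite natr_char0.
apply: (mulfI c0); rewrite -md mcoeff_deriv mulrnAr uP ?md //.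
rewrite -mcoeff_deriv /g mderiv_sum.
under eq_bigr do rewrite mderivM clb.
rewrite big_split /= mcoeffD mcoeff_euler -natr1 mulrDl mul1r addrC.
congr (_ + _); rewrite (bigD1 i) //= big1 => [|j ji].
  by rewrite mderivXX eqxx mul1r addr0.
by rewrite mderivXX (negPf ji) mul0r.
Qed.

End Poincare.

Section Symplectic.
Variables (k : fieldType) (m : nat).
Implicit Types (p q : 'I_(m + m)).

(** With [X_1, ..., X_m] first and the conjugate variables next, the symplectic
    form is half the sum of [sgn q dX_(conj_ord q) dX_q] and the contact form is
    [dX_(2m+1)] plus the sum of [sgn q X_(conj_ord q) dX_q]. *)
Definition conj_ord p : 'I_(m + m) :=
  match split p with inl i => rshift m i | inr i => lshift m i end.

Definition sgn p : k := if split p is inl _ then - 1 else 1.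

Lemma split_lshift (i : 'I_m) : split (lshift m i) = inl i.
Proof. exact: (unsplitK (inl i)). Qed.

Lemma split_rshift (i : 'I_m) : split (rshift m i) = inr i.
Proof. exact: (unsplitK (inr i)). Qed.



Lemma conj_ordK : involutive conj_ord.
Proof.
by move=> p; rewrite /conj_ord; case: (split_ordP p) => i ->;
  rewrite ?split_lshift ?split_rshift.
Qed.

Lemma conj_ord_neq p : conj_ord p != p.
Proof.
by rewrite /conj_ord; case: (split_ordP p) => i ->; rewrite eq_shift.
Qed.

Lemma sgn_conj_ord p : sgn (conj_ord p) = - sgn p.
Proof.
rewrite /sgn /conj_ord; case: (split_ordP p) => i _.
  by rewrite split_rshift opprK.
by rewrite split_lshift.
Qed.

Lemma sgn_sq p : sgn p * sgn p = 1.
Proof. by rewrite /sgn; case: split => _; rewrite ?mulrNN mulr1. Qed.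

Lemma sgn_neq0 p : sgn p != 0.
Proof.
by apply: contra_eqN (sgn_sq p) => /eqP ->; rewrite mul0r eq_sym oner_eq0.
Qed.

End Symplectic.

Section Hamiltonian.
Variables (k : fieldType) (k0 : [pchar k] =i pred0) (m : nat).
Let n := (m + m)%N.
Implicit Types (u v : {mpoly k[n]}) (a : W k n) (p q : 'I_n) (e : 'X_{1..n}).

Lemma H_form_act a : form_act a (H_form k m) =
  \sum_(i < m) (wedge (dform0 (a (lshift m i))) (dX k (rshift m i))
                + wedge (dX k (lshift m i)) (dform0 (a (rshift m i)))).
Proof.
have lr (i : 'I_m) : (lshift m i < rshift m i)%N.
  by rewrite /= (leq_trans (ltn_ord i)) // leq_addr.
have nlr (i : 'I_m) : lshift m i != rshift m i by rewrite eq_shift.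
rewrite (@form_act_supported _ _ _ (fun i => [set lshift m i; rshift m i])
  (fun=> 1)).
  by apply: eq_bigr => i _; apply: act_term_pair.
move=> I; rewrite /H_form sum_ffunE; apply: eq_bigr => i _.
by rewrite wedge_dX ffunE nlr ltnNge ltnW.
Qed.

Lemma sum_delta2 (F : 'I_n -> 'I_n -> {mpoly k[n]}) p0 q0 :
  \sum_q \sum_p F p q * ((p == p0) && (q == q0))%:R = F p0 q0.
Proof.
rewrite (bigD1 q0) //= (bigD1 p0) //= !eqxx mulr1 !big1 ?addr0 //.
  by move=> q qq; rewrite big1 // => p _; rewrite (negPf qq) andbF mulr0.
by move=> p pp; rewrite (negPf pp) mulr0.
Qed.

(** The coefficients of the contraction of [a] with the symplectic form. *)
Let contr a q : {mpoly k[n]} := sgn k q *: a (conj_ord q).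

Lemma H_form_act_coef a K : form_act a (H_form k m) K =
  \sum_q \sum_p (contr a q)^`M(p) * wedge (dX k p) (dX k q) K.
Proof.
rewrite H_form_act sum_ffunE [RHS]big_split_ord /= addrC -big_split /=.
apply: eq_bigr => i _; rewrite ffunE -!/(oneform _).
rewrite wedge_oneform_dX wedge_dX_oneform.
congr (_ + _); apply: eq_bigr => p _.
  by rewrite /contr /sgn /conj_ord split_rshift scale1r.
rewrite /contr /sgn /conj_ord split_lshift scaleN1r mderivN wedge_dXC !ffunE.
by rewrite mulrN mulNr.
Qed.

(** The Lie derivative of the symplectic form is the exterior derivative of its
    contraction with [a], so the condition is that this 1-form be closed. *)
Lemma H_memP a : H_mem a <-> forall p q, (contr a q)^`M(p) = (contr a p)^`M(q).
Proof.
split=> [Ha|cl].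
  have H p q : (p < q)%N -> (contr a q)^`M(p) = (contr a p)^`M(q).
    move=> pq; apply/eqP; rewrite -subr_eq0; apply/eqP.
    have npq : p != q by apply: contraTneq pq => ->; rewrite ltnn.
    have /ffunP/(_ [set p; q]) := Ha; rewrite H_form_act_coef [RHS]ffunE => <-.
    under [RHS]eq_bigr do under eq_bigr do rewrite wedge_dX_pair // mulrBr.
    under [RHS]eq_bigr do rewrite sumrB.
    rewrite sumrB !sum_delta2 //.
  move=> p q; case: (ltngtP p q) => [|qp|/val_inj -> //]; first exact: H.
  by rewrite (H _ _ qp).
apply/ffunP => K; rewrite H_form_act_coef [RHS]ffunE; set T := LHS.
have TN : T = - T.
  rewrite {1}/T exchange_big /T -sumrN; apply: eq_bigr => p _ /=.
  rewrite -sumrN; apply: eq_bigr => q _.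
  by rewrite wedge_dXC ffunE mulrN cl.
have /eqP : 2%:R *: T = 0 by rewrite scaler_nat mulr2n {2}TN subrr.
by rewrite scaler_eq0 natr_char0 // => /eqP.
Qed.

(** The field whose contraction with the symplectic form is [- du]. *)
Definition ham u : W k n := [ffun p => sgn k p *: u^`M(conj_ord p)].

Lemma ham_linear c u v : ham (c *: u + v) = c *: ham u + ham v.
Proof.
apply/ffunP => p; rewrite !ffunE mderivD mderivZ scalerDr !scalerA.
by rewrite [c * _]mulrC.
Qed.

Lemma hamZ c u : ham (c *: u) = c *: ham u.
Proof.
by apply/ffunP => p; rewrite !ffunE mderivZ !scalerA [c * _]mulrC.
Qed.

Lemma H_mem_ham a : H_mem a <-> exists u, a = ham u.
Proof.
split=> [/H_memP /(closed_exact k0) [u uP]|[u ->]].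
  exists (- u); apply/ffunP => p; rewrite ffunE mderivN uP /contr conj_ordK.
  by rewrite sgn_conj_ord scaleNr opprK scalerA sgn_sq scale1r.
have E q : contr (ham u) q = - u^`M(q).
  by rewrite /contr ffunE conj_ordK sgn_conj_ord scalerA mulrN sgn_sq scaleN1r.
by apply/H_memP => p q; rewrite !E !mderivN mderiv_comm.
Qed.

Lemma lie_ham u v : lie (ham u) (ham v) = ham (der (ham u) v).
Proof.
apply/ffunP => p; rewrite lieWE !ffunE !derZ -scalerBr mderiv_der.
congr (_ *: (_ + _)); rewrite /der -sumrN.
rewrite (reindex_inj (inv_inj (@conj_ordK m))) /=; apply: eq_bigr => q _.
rewrite !ffunE !mderivZ conj_ordK sgn_conj_ord scaleNr mulNr opprK -!scalerAl.
by rewrite mderiv_comm mulrC.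
Qed.

Lemma H_lie a b : H_mem a -> H_mem b -> H_mem (lie a b).
Proof.
move=> /H_mem_ham [u ->] /H_mem_ham [v ->]; rewrite lie_ham.
by apply/H_mem_ham; exists (der (ham u) v).
Qed.

Lemma ham_monomial_homog e (d : int) : (mdeg e)%:Z = 2 + d ->
  W_homog (@std_wt n) d (ham 'X_[e]).
Proof.
move=> ed; apply/W_homogP => p; rewrite ffunE; apply: poly_homogZ.
have -> : (std_wt p)%:Z + d = (wdeg (@std_wt n) e)%:Z - (std_wt (conj_ord p))%:Z.
  by rewrite wdeg_std ed /std_wt; lia.
by apply: poly_homog_deriv; apply: poly_homogX.
Qed.

(** The Poisson bracket with [X_p^(i+2)] is [X_p^(i+1)] times the derivative in
    the conjugate variable, so it reaches every monomial divisible by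
    [X_p^(i+1)]. *)
Lemma ham_lie e i p : (i < e p)%N ->
  lie (ham 'X_[U_(p) *+ i.+2]) (ham 'X_[e - U_(p) *+ i.+1 + U_(conj_ord p)])
  = (sgn k (conj_ord p) * (i.+2%:R * (e (conj_ord p)).+1%:R)) *: ham 'X_[e].
Proof.
move=> ie; rewrite lie_ham -hamZ; congr ham.
rewrite /der (bigD1 (conj_ord p)) //= big1 => [|q qp]; last first.
  rewrite ffunE mderiv_pow_neq ?scaler0 ?mul0r //.
  by apply: contraNneq qp => ->; rewrite conj_ordK.
rewrite addr0 ffunE conj_ordK mderiv_pow mderivXU -!scalerAl -scalerAr -mpolyXD.
rewrite !scalerA mnmBE mulmnE mnm1E eq_sym (negPf (conj_ord_neq p)) subn0 mulrA.
congr (_ *: 'X_[_]); apply/mnmP => s; rewrite !(mnmDE, mnmBE, mulmnE, mnm1E).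
by case: (p =P s) => [<-|_]; lia.
Qed.

Lemma H_well_covered :
  zgraded_well_covered (@H_mem k m)
    (restrict_grading (@H_mem k m) (W_homog (@std_wt n))).
Proof.
have Hham u : H_mem (ham u) by apply/H_mem_ham; exists u.
apply: (@W_subalgebra_well_covered _ _ _ _ _ (fun e => ham 'X_[e])
  (fun e => (mdeg e)%:Z - 2) (fun d => monomials n d.+2)).
- exact: H_lie.
- move=> a; split.
    move=> /H_mem_ham [u ->].
    apply: (@monomial_span _ _ (W k n) ham) => [c v w||e _].
    + exact: ham_linear.
    + exact: lin_span_subspace.
    by apply: lin_span_gen; exists e.
  apply: (@lin_span_min _ (W k n)) => [|_ [e ->]]; last exact: Hham.
  split=> [|c x y /H_mem_ham [u ->] /H_mem_ham [v ->]].
    apply/H_mem_ham; exists 0; apply/ffunP => p.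
    by rewrite !ffunE mderiv0 scaler0.
  by rewrite -ham_linear.
- by move=> e; apply: ham_monomial_homog; lia.
- by move=> e d ed; apply: mem_monomials; lia.
move=> N; exists (n * N.+1 + (2 * N).+1)%N, (iota 0 N.+1); split.
- exact: iota_uniq.
- exact: size_iota.
move=> i; rewrite mem_iota => /andP [_ iN]; split; first lia.
move=> e fe.
have [|p ep] := @exists_large_exponent n e N.+1; first by move: fe; lia.
have ie : (i < e p)%N by lia.
apply: (@lie_span_scaled _ (W k n) _ _ _ _ _ _ _ _ _ (ham_lie ie)).
- by rewrite !mulf_neq0 ?sgn_neq0 ?natr_char0.
- split=> //; apply: ham_monomial_homog; rewrite mdegMn mdeg1; lia.
split=> //; apply: ham_monomial_homog; rewrite mdegD mdeg1.
have := mdeg_subU ie; have : (e p <= mdeg e)%N.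
  by rewrite mdegE (bigD1 p) //= leq_addr.
by move=> ? ->; lia.
Qed.

End Hamiltonian.

(** * Contact vector fields *)

Section LieDerivative.
Variables (k : fieldType) (n : nat).
Implicit Types (a b : W k n) (c : 'I_n -> {mpoly k[n]}) (f p q : {mpoly k[n]}).

Definition lie_deriv a c (i : 'I_n) : {mpoly k[n]} :=
  der a (c i) + \sum_(j < n) c j * (a j)^`M(i).

Definition pairing c a : {mpoly k[n]} := \sum_(j < n) c j * a j.

Lemma lie_derivM a f c i :
  lie_deriv a (fun j => f * c j) i = der a f * c i + f * lie_deriv a c i.
Proof.
rewrite /lie_deriv derM mulrDr -addrA; congr (_ + (_ + _)).
by rewrite mulr_sumr; apply: eq_bigr => j _; rewrite mulrA.
Qed.

(** [[L_a, L_b] = L_[a,b]] on 1-forms; the fields that multiply a given form by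
    a function are therefore closed under brackets. *)
Lemma lie_deriv_bracket a b c i : lie_deriv (lie a b) c i =
  lie_deriv a (lie_deriv b c) i - lie_deriv b (lie_deriv a c) i.
Proof.
have E a' b' : lie_deriv a' (lie_deriv b' c) i = der a' (der b' (c i))
    + \sum_(j < n) (der a' (c j) * (b' j)^`M(i) + der b' (c j) * (a' j)^`M(i))
    + \sum_(j < n) c j * (der a' (b' j))^`M(i).
  have F : \sum_(j < n) c j * (der a' (b' j))^`M(i) =
      \sum_(j < n) c j * der a' (b' j)^`M(i)
      + \sum_(l < n) (\sum_(j < n) c j * (b' j)^`M(l)) * (a' l)^`M(i).
    transitivity (\sum_(j < n) (c j * der a' (b' j)^`M(i)
        + \sum_(l < n) c j * ((a' l)^`M(i) * (b' j)^`M(l)))).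
      by apply: eq_bigr => j _; rewrite mderiv_der mulrDr [X in _ + X]mulr_sumr.
    rewrite big_split /=; congr (_ + _); rewrite exchange_big /=.
    apply: eq_bigr => l _.
    by rewrite mulr_suml; apply: eq_bigr => j _; ring.
  rewrite F /lie_deriv derD [X in _ + X + _ = _]der_sumr -!addrA; congr (_ + _).
  under eq_bigr do rewrite derM.
  under [X in _ + X = _]eq_bigr do rewrite mulrDl.
  by rewrite !big_split /= addrACA.
rewrite !E /lie_deriv der_lie.
under eq_bigr do rewrite lieWE ffunE mderivB mulrBr.
rewrite sumrB [\sum_(j < n) (der b (c j) * _ + _)](eq_bigr (fun j =>
  der a (c j) * (b j)^`M(i) + der b (c j) * (a j)^`M(i))); last first.
  by move=> j _; rewrite addrC.
by ring.
Qed.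

Lemma pairing_bracket a b c :
  pairing c (lie a b) = der a (pairing c b) - pairing (lie_deriv a c) b.
Proof.
have E1 : der a (pairing c b) =
    \sum_(j < n) der a (c j) * b j + \sum_(j < n) c j * der a (b j).
  by rewrite der_sumr -big_split; apply: eq_bigr => j _ /=; rewrite derM.
have E2 : pairing (lie_deriv a c) b = \sum_(j < n) der a (c j) * b j
    + \sum_(j < n) \sum_(i < n) c j * (a j)^`M(i) * b i.
  rewrite exchange_big -big_split /=; apply: eq_bigr => i _.
  by rewrite mulrDl [X in _ + X]mulr_suml.
rewrite E1 E2 opprD addrACA subrr add0r -sumrB.
apply: eq_bigr => j _; rewrite lieWE ffunE mulrBr; congr (_ - _).
by rewrite [der b _]/der mulr_sumr; apply: eq_bigr => i _; ring.
Qed.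

(** The Cartan formula for the Lie derivative of a 1-form. *)
Lemma lie_deriv_cartan a c i : lie_deriv a c i =
  (pairing c a)^`M(i) + (der a (c i) - \sum_(j < n) (c j)^`M(i) * a j).
Proof.
rewrite /pairing mderiv_sum; under [X in X + _]eq_bigr do rewrite mderivM.
by rewrite big_split /= /lie_deriv; ring.
Qed.

End LieDerivative.

Section Contact.
Variables (k : fieldType) (k0 : [pchar k] =i pred0) (m : nat).
Local Notation n := (m + m + 1)%N.
Implicit Types (u v : {mpoly k[n]}) (a b : W k n) (p : 'I_n) (q r : 'I_(m + m)).
Implicit Types (e : 'X_{1..n}).

Local Notation x q := (lshift 1 q : 'I_n).
Local Notation t := (rshift (m + m) ord0 : 'I_n).

Lemma split_x q : split (x q) = inl q.
Proof. exact: (unsplitK (inl q)). Qed.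

Lemma split_t : split t = inr ord0.
Proof. exact: (unsplitK (inr ord0)). Qed.

Lemma x_neq_t q : (x q == t) = false.
Proof. by rewrite eq_shift. Qed.

Lemma x_inj q r : (x q == x r) = (q == r).
Proof. by rewrite eq_shift. Qed.

Lemma big_xt (V : nmodType) (F : 'I_n -> V) :
  \sum_p F p = \sum_q F (x q) + F t.
Proof. by rewrite big_split_ord /= big_ord1. Qed.

Definition alpha p : {mpoly k[n]} :=
  if split p is inl q then sgn k q *: 'X_(x (conj_ord q)) else 1.

Lemma alpha_x q : alpha (x q) = sgn k q *: 'X_(x (conj_ord q)).
Proof. by rewrite /alpha split_x. Qed.

Lemma alpha_t : alpha t = 1.
Proof. by rewrite /alpha split_t. Qed.

Lemma K_formE : K_form k m = oneform alpha.
Proof.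
rewrite /oneform big_xt big_split_ord addrC /= -big_split /= alpha_t.
rewrite [wedge (form0 1) _]wedge_form1l /K_form; congr (_ + _).
apply: eq_bigr => i _; rewrite !alpha_x /sgn /conj_ord split_lshift split_rshift.
rewrite !wedge_form0l; apply/ffunP => K; rewrite !ffunE.
by rewrite scale1r scaleN1r mulNr addrC.
Qed.

Lemma K_memP a :
  K_mem a <-> exists f, forall p, lie_deriv a alpha p = f * alpha p.
Proof.
rewrite /K_mem K_formE form_act_oneform.
split=> [[f]|[f fP]]; last first.
  by exists f; rewrite wedge_form0_oneform; apply/oneform_inj.
by rewrite wedge_form0_oneform => /oneform_inj fP; exists f.
Qed.

Lemma K_lie a b : K_mem a -> K_mem b -> K_mem (lie a b).
Proof.
move=> /K_memP [f fP] /K_memP [g gP]; apply/K_memP.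
exists (der a g - der b f) => p; rewrite lie_deriv_bracket.
have ext c c' d : c =1 c' -> lie_deriv d c p = lie_deriv d c' p.
  move=> cc; rewrite /lie_deriv cc; congr (_ + _).
  by apply: eq_bigr => j _; rewrite cc.
by rewrite (ext _ _ _ a gP) (ext _ _ _ b fP) !lie_derivM fP gP; ring.
Qed.

Lemma lie_deriv_alpha_x a q : lie_deriv a alpha (x q) =
  (pairing alpha a)^`M(x q) + (2%:R * sgn k q) *: a (x (conj_ord q)).
Proof.
rewrite lie_deriv_cartan; congr (_ + _).
rewrite big_xt alpha_t mderivC mul0r addr0 alpha_x derZ derX.
rewrite (bigD1 (conj_ord q)) //= big1 => [|r rq]; rewrite alpha_x mderivZ mderivXX.
  rewrite conj_ordK eqxx sgn_conj_ord scaleNr mulNr -scalerAl mul1r addr0 opprK.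
  rewrite -scalerDl.
  by congr (_ *: _); ring.
rewrite x_inj (_ : (conj_ord r == q) = false) ?scaler0 ?mul0r //.
by apply: contraNF rq => /eqP <-; rewrite conj_ordK.
Qed.

Lemma lie_deriv_alpha_t a : lie_deriv a alpha t = (pairing alpha a)^`M(t).
Proof.
rewrite lie_deriv_cartan big_xt alpha_t !mderivC mul0r addr0.
rewrite der1 big1 ?subr0 ?addr0 // => q _.
by rewrite alpha_x mderivZ mderivXX x_neq_t scaler0 mul0r.
Qed.

(** The contact field on which the contact form takes the value [2 u]. *)
Definition contact u : W k n :=
  [ffun p => if split p is inl q
             then 'X_p * u^`M(t) + sgn k q *: u^`M(x (conj_ord q))
             else 2%:R *: u - \sum_q 'X_(x q) * u^`M(x q)].

Lemma contact_x u q :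
  contact u (x q) = 'X_(x q) * u^`M(t) + sgn k q *: u^`M(x (conj_ord q)).
Proof. by rewrite ffunE split_x. Qed.

Lemma contact_t u : contact u t = 2%:R *: u - \sum_q 'X_(x q) * u^`M(x q).
Proof. by rewrite ffunE split_t. Qed.

Lemma W_ext a b : (forall q, a (x q) = b (x q)) -> a t = b t -> a = b.
Proof.
move=> Ex Et; apply/ffunP => p; case: (split_ordP p) => [q ->|i ->] //.
by rewrite (ord1 i).
Qed.

Lemma contact_linear c u v : contact (c *: u + v) = c *: contact u + contact v.
Proof.
apply: W_ext => [q|]; rewrite !ffunE ?split_x ?split_t.
  rewrite !mderivD !mderivZ mulrDr !scalerDr -scalerAr !scalerA.
  rewrite [c * sgn k q]mulrC.
  by rewrite addrACA.
under eq_bigr do rewrite mderivD mderivZ mulrDr -scalerAr.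
rewrite big_split -scaler_sumr /= !scalerDr !scalerA [c * 2%:R]mulrC.
by rewrite scalerN opprD addrACA.
Qed.

Lemma contactZ c u : contact (c *: u) = c *: contact u.
Proof.
have c0 : contact 0 = 0.
  by have := contact_linear (-1) 0 0; rewrite !scaleN1r !addNr.
by rewrite -[c *: u]addr0 contact_linear c0 addr0.
Qed.

Lemma pairing_contact u : pairing alpha (contact u) = 2%:R *: u.
Proof.
rewrite /pairing big_xt alpha_t mul1r contact_t.
under eq_bigr do rewrite alpha_x contact_x mulrDr -!scalerAl -scalerAr
  scalerA sgn_sq scale1r.
rewrite big_split /= big_split_ord /= -big_split big1 ?add0r => [|i _] /=.
  rewrite [X in X + _](reindex_inj (inv_inj (@conj_ordK m))) /=.
  under eq_bigr do rewrite conj_ordK.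
  by rewrite addrC subrK.
rewrite /sgn /conj_ord split_lshift split_rshift scaleN1r scale1r.
by rewrite [X in _ + X]mulrCA addNr.
Qed.

Lemma lie_deriv_contact u p :
  lie_deriv (contact u) alpha p = (2%:R *: u^`M(t)) * alpha p.
Proof.
case: (split_ordP p) => [q ->|i ->]; last first.
  by rewrite (ord1 i) lie_deriv_alpha_t pairing_contact mderivZ alpha_t mulr1.
rewrite lie_deriv_alpha_x pairing_contact mderivZ contact_x conj_ordK sgn_conj_ord.
rewrite alpha_x scalerDr !scalerA mulrN -mulrA sgn_sq mulr1 scaleNr.
rewrite addrC subrK -scalerAr -scalerAl scalerA.
by rewrite [_ * 'X__]mulrC [2%:R * _]mulrC.
Qed.

Lemma two_neq0 : 2%:R != 0 :> k.
Proof. by rewrite natr_char0. Qed.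

(** By the Cartan formula the equation for [L_a alpha] determines [a] from its
    pairing with [alpha]: the [t]-component gives the multiplier, the others
    give the components of [a]. *)
Lemma K_mem_contact a : K_mem a <-> exists u, a = contact u.
Proof.
split=> [/K_memP [f fP]|[u ->]]; last first.
  by apply/K_memP; exists (2%:R *: u^`M(t)); apply: lie_deriv_contact.
pose u := 2%:R^-1 *: pairing alpha a.
have uE : pairing alpha a = 2%:R *: u.
  by rewrite scalerA mulfV ?two_neq0 // scale1r.
have fE : f = 2%:R *: u^`M(t).
  by have := fP t; rewrite lie_deriv_alpha_t uE alpha_t mulr1 mderivZ.
have ax q : a (x q) = contact u (x q).
  have := fP (x (conj_ord q)); rewrite lie_deriv_alpha_x uE conj_ordK alpha_x conj_ordK fE.
  rewrite mderivZ sgn_conj_ord => E.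
  have c0 : 2%:R * - sgn k q != 0.
    by rewrite mulf_neq0 ?two_neq0 ?oppr_eq0 ?sgn_neq0.
  apply: (scalerI c0); move: E => /(canRL (addKr _)) ->.
  rewrite contact_x scalerDr scalerA -mulrA mulNr sgn_sq mulrN1 scaleNr addrC.
  rewrite scaleNr !mulrN scaleNr -scalerAl -scalerAr scalerA.
  by rewrite [_ * 'X__]mulrC.
exists u; apply: W_ext => //.
have := uE; rewrite -pairing_contact /pairing !big_xt.
under eq_bigr do rewrite ax.
by rewrite alpha_t !mul1r => /addrI.
Qed.

Definition contact_bracket u v : {mpoly k[n]} :=
  der (contact u) v - 2%:R *: (u^`M(t) * v).

(** The bracket is a contact field, so its potential is read off from its
    pairing with [alpha]. *)
Lemma lie_contact u v :
  lie (contact u) (contact v) = contact (contact_bracket u v).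
Proof.
have /K_mem_contact [w E] : K_mem (lie (contact u) (contact v)).
  by apply: K_lie; apply/K_mem_contact; [exists u | exists v].
rewrite E; congr contact; apply: (scalerI two_neq0).
rewrite -pairing_contact -E pairing_bracket pairing_contact derZ scalerBr.
congr (_ - _); rewrite /pairing.
under eq_bigr do rewrite lie_deriv_contact -mulrA.
by rewrite -mulr_sumr -/(pairing _ _) pairing_contact -scalerAl -scalerAr.
Qed.

Lemma wt_x q : K_wt (x q) = 1%N.
Proof. by rewrite /K_wt x_neq_t. Qed.

Lemma wt_t : K_wt t = 2%N.
Proof. by rewrite /K_wt eqxx. Qed.

Lemma contact_monomial_homog e (d : int) : (wdeg (@K_wt m) e)%:Z = 2 + d ->
  W_homog (@K_wt m) d (contact 'X_[e]).
Proof.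
move=> ed.
have homogX p : poly_homog (@K_wt m) (K_wt p)%:Z ('X_p : {mpoly k[n]}).
  by rewrite -(wdegU (@K_wt m) p); apply: poly_homogX.
have homogD p : poly_homog (@K_wt m) (2 + d - (K_wt p)%:Z)
    (('X_[e] : {mpoly k[n]})^`M(p)).
  by rewrite -ed; apply: poly_homog_deriv; apply: poly_homogX.
apply/W_homogP => p; case: (split_ordP p) => [q ->|i ->].
  rewrite contact_x wt_x; apply: poly_homogD.
    have -> : 1%:Z + d = (K_wt (x q))%:Z + (2 + d - (K_wt t)%:Z).
      by rewrite wt_x wt_t; lia.
    exact: poly_homogM.
  apply: poly_homogZ; have -> : 1%:Z + d = 2 + d - (K_wt (x (conj_ord q)))%:Z.
    by rewrite wt_x; lia.
  exact: homogD.
rewrite (ord1 i) contact_t wt_t; apply: poly_homogD.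
  by apply: poly_homogZ; rewrite -ed; apply: poly_homogX.
apply/poly_homogN/poly_homog_sum => q _.
have -> : 2%:Z + d = (K_wt (x q))%:Z + (2 + d - (K_wt (x q))%:Z) by lia.
exact: poly_homogM.
Qed.

(** The bracket with [X_q^(i+2)] has, besides the Poisson term, a term with a
    lower exponent of the contact variable. *)
Lemma contact_bracket_x e i q : (i < e (x q))%N ->
  contact_bracket 'X_[U_(x q) *+ i.+2] 'X_[e - U_(x q) *+ i.+1 + U_(x (conj_ord q))]
  = (sgn k (conj_ord q) * (i.+2%:R * (e (x (conj_ord q))).+1%:R)) *: 'X_[e]
    - (i * e t)%:R *: 'X_[e + U_(x q) + U_(x (conj_ord q)) - U_(t)].
Proof.
move=> ie; set u := 'X_[_ *+ i.+2]; set v := 'X_[_ + _].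
have ut : u^`M(t) = 0 by rewrite mderiv_pow_neq ?x_neq_t.
have neq_c : (x q == x (conj_ord q)) = false.
  by rewrite x_inj eq_sym (negPf (conj_ord_neq q)).
rewrite /contact_bracket ut mul0r scaler0 subr0 /der big_xt.
rewrite (bigD1 (conj_ord q)) //= big1 => [|r rq]; last first.
  rewrite contact_x ut mulr0 add0r mderiv_pow_neq ?scaler0 ?mul0r //.
  by rewrite x_inj; apply: contraNneq rq => ->; rewrite conj_ordK.
rewrite addr0 contact_x ut mulr0 add0r conj_ordK mderiv_pow mderivXU; congr (_ + _).
  rewrite -!scalerAl -scalerAr -mpolyXD !scalerA.
  rewrite mnmBE mulmnE mnm1E neq_c subn0 mulrA.
  congr (_ *: 'X_[_]); apply/mnmP => s; rewrite !(mnmDE, mnmBE, mulmnE, mnm1E).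
  by case: (x q =P s) => [<-|_]; lia.
rewrite contact_t (bigD1 q) //= big1 => [|r rq]; last first.
  by rewrite mderiv_pow_neq ?mulr0 // x_inj eq_sym.
rewrite addr0 mulX_mderivX mulmnE mnm1E eqxx mul1n -scalerBl mderivX.
rewrite !(mnmDE, mnmBE, mulmnE, mnm1E) !x_neq_t subn0 addn0.
rewrite -scalerAl -scalerAr scalerA -mpolyXD -scaleNr.
have -> : (2%:R - i.+2%:R) * (e t)%:R = - (i * e t)%:R :> k.
  by rewrite -addn2 natrD natrM; ring.
have [->|et] := eqVneq (e t) 0%N; first by rewrite muln0 oppr0 !scale0r.
congr (_ *: 'X_[_]); apply/mnmP => s; rewrite !(mnmDE, mnmBE, mulmnE, mnm1E).
case: (x q =P s) => [<-|_]; first by rewrite [t == _]eq_sym x_neq_t; lia.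
case: (t =P s) => [<-|_]; lia.
Qed.

(** For monomials whose large exponent is that of the contact variable; the
    scalar is then positive. *)
Lemma contact_bracket_t e h : (h <= e t)%N ->
  contact_bracket 'X_[U_(t) *+ h.+1] 'X_[e - U_(t) *+ h]
  = ((2 * (e t - h))%:R + (h.+1 * \sum_q e (x q))%:R - (2 * h.+1)%:R) *: 'X_[e].
Proof.
move=> he; set u := 'X_[_ *+ h.+1]; set v := 'X_[_ - _].
have ux q : u^`M(x q) = 0 by rewrite mderiv_pow_neq // eq_sym x_neq_t.
have uvE : 'X_[U_(t) *+ h] * v = 'X_[e].
  rewrite -mpolyXD; congr 'X_[_]; apply/mnmP => s.
  rewrite !(mnmDE, mnmBE, mulmnE, mnm1E).
  by case: (t =P s) => [<-|_]; lia.
rewrite /contact_bracket mderiv_pow -scalerAl uvE scalerA -natrM.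
rewrite scalerBl scalerDl; congr (_ - _); rewrite /der big_xt addrC; congr (_ + _).
  rewrite contact_t big1 => [|q _]; last by rewrite ux mulr0.
  rewrite subr0 /u mulmSr mpolyXD -scalerAl -mulrA mulX_mderivX.
  rewrite -scalerAr uvE scalerA mnmBE mulmnE mnm1E eqxx mul1n.
  by rewrite natrM.
have E q : contact u (x q) * v^`M(x q) = (h.+1%:R * (e (x q))%:R) *: 'X_[e].
  rewrite contact_x ux scaler0 addr0 mderiv_pow -scalerAr -scalerAl.
  rewrite mulrAC mulX_mderivX -scalerAl [v * _]mulrC uvE scalerA.
  by rewrite mnmBE mulmnE mnm1E [t == _]eq_sym x_neq_t subn0.
by rewrite (eq_bigr _ (fun q _ => E q)) -scaler_suml -mulr_sumr natrM natr_sum.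
Qed.

Lemma K_wdeg e : wdeg (@K_wt m) e = (\sum_q e (x q) + 2 * e t)%N.
Proof.
rewrite /wdeg big_xt wt_t; congr (_ + _)%N; apply: eq_bigr => q _.
by rewrite wt_x mul1n.
Qed.

Lemma K_well_covered :
  zgraded_well_covered (@K_mem k m)
    (restrict_grading (@K_mem k m) (W_homog (@K_wt m))).
Proof.
have Kc u : K_mem (contact u) by apply/K_mem_contact; exists u.
have wt0 p : (0 < K_wt p)%N by rewrite /K_wt; case: ifP.
apply: (@W_subalgebra_well_covered _ _ _ _ _ (fun e => contact 'X_[e])
  (fun e => (wdeg (@K_wt m) e)%:Z - 2) (fun d => monomials n d.+2)).
- exact: K_lie.
- move=> a; split.
    move=> /K_mem_contact [u ->].
    apply: (@monomial_span _ _ (W k n) contact) => [c v w||e _].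
    + exact: contact_linear.
    + exact: lin_span_subspace.
    by apply: lin_span_gen; exists e.
  apply: (@lin_span_min _ (W k n)) => [|_ [e ->]]; last exact: Kc.
  split=> [|c y z /K_mem_contact [u ->] /K_mem_contact [v ->]].
    apply/K_mem_contact; exists 0.
    by have := contactZ 0 0; rewrite !scale0r.
  by rewrite -contact_linear.
- by move=> e; apply: contact_monomial_homog; lia.
- move=> e d ed; apply: mem_monomials; have := mdeg_wdeg e wt0; lia.
(* Powers of the contact variable have even degree, so [i] is taken even. With
   weights 1 and 2, a monomial whose exponents are all at most [2 N + 1] has
   weight at most [(m + m + 2) * (2 N + 1)]. *)
move=> N; exists ((m + m + 2) * (2 * N).+1 + (4 * N).+1)%N,
  [seq (2 * h)%N | h <- iota 0 N.+1]; split.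
- by rewrite map_inj_uniq ?iota_uniq // => h h'; lia.
- by rewrite size_map size_iota.
move=> _ /mapP [h + ->]; rewrite mem_iota => /andP [_ hN]; split; first lia.
move=> e; set d := _ - 2; move=> fe; set P := lie_span _ _.
have sP : subspace P by exact: lin_span_subspace.
have ed : (wdeg (@K_wt m) e)%:Z = 2 + d by rewrite /d; lia.
clearbody d.
have bracketP u v : W_homog (@K_wt m) (2 * h)%:Z (contact u) ->
    W_homog (@K_wt m) (d - (2 * h)%:Z) (contact v) ->
    P (contact (contact_bracket u v)).
  by move=> Wu Wv; rewrite -lie_contact; apply: lie_span_gen; split.
have scaledP c u : c != 0 -> P (contact (c *: u)) -> P (contact u).
  move=> c_neq0; rewrite contactZ => /(subspaceZ c^-1 sP).
  by rewrite scalerA mulVf // scale1r.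
have [/existsP [q eq]|/existsPn small] :=
  boolP [exists q, (2 * N).+1 < e (x q)]%N.
  have ie : (2 * h < e (x q))%N by lia.
  (* The lower-order term of the bracket forces an induction on the exponent of
     the contact variable. *)
  have [s se] := ubnP (e t); elim: s e se ed ie {fe eq} => // s IHs e se ed ie.
  have := contact_bracket_x ie.
  set c := _ * _; set c' := _%:R; set e' := (_ - U_(t))%MM => E.
  have br : P (contact (c *: 'X_[e] - c' *: 'X_[e'])).
    rewrite -E; apply: bracketP; apply: contact_monomial_homog.
      by rewrite wdegMn wdegU wt_x; lia.
    have := wdeg_subU (@K_wt m) ie; rewrite wdegD wdegU !wt_x; lia.
  apply: (scaledP c); first by rewrite !mulf_neq0 ?sgn_neq0 ?natr_char0.
  have [et|et] := eqVneq (e t) 0%N.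
    by move: br; rewrite /c' et muln0 scale0r subr0.
  move: br; rewrite -scaleNr addrC contact_linear => br.
  have Pe' : P (contact 'X_[e']).
    apply: IHs.
    - by rewrite mnmBE !mnmDE !mnm1E !x_neq_t eqxx; lia.
    - have e1 : (1 <= (e + U_(x q) + U_(x (conj_ord q)))%MM t)%N.
        by rewrite !mnmDE; lia.
      have := wdeg_subU (@K_wt m) e1.
      by rewrite mulm1n !wdegD !wdegU !wt_x wt_t -/e'; lia.
    by rewrite mnmBE !mnmDE !mnm1E [t == _]eq_sym x_neq_t eqxx; lia.
  have := subspaceB sP br (subspaceZ (- c') sP Pe').
  by rewrite addrAC subrr add0r.
have et : (2 * h.+1 <= e t)%N.
  have := K_wdeg e; have : (\sum_q e (x q) <= (m + m) * (2 * N).+1)%N.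
    rewrite -[X in (_ <= X * _)%N]card_ord -sum_nat_const.
    by apply: leq_sum => q _; rewrite leqNgt.
  by move: fe ed hN; lia.
have he : (h <= e t)%N by lia.
have := contact_bracket_t he; set c := (X in X *: _) => E.
apply: (scaledP c).
  by rewrite /c -natrD -natrB ?natr_char0 //; lia.
rewrite -E; apply: bracketP; apply: contact_monomial_homog.
  by rewrite wdegMn wdegU wt_t; lia.
by have := wdeg_subU (@K_wt m) he; rewrite wt_t; lia.
Qed.

End Contact.

(** * All the algebras are well-covered *)

Theorem theorem2p31 (k : fieldType) (k_char0 : [pchar k] =i pred0) :
  [/\ zgraded_well_covered (L := Vir k) (fun _ => True) (@vir_homog k),
      forall n : nat, (1 <= n)%N ->
        zgraded_well_covered (L := W k n) (fun _ => True)
          (W_homog (@std_wt n)),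
      forall n : nat, (1 <= n)%N ->
        zgraded_well_covered (L := W k n) (@S_mem k n)
          (restrict_grading (@S_mem k n) (W_homog (@std_wt n))),
      forall m : nat, (1 <= m)%N ->
        zgraded_well_covered (L := W k (m + m)) (@H_mem k m)
          (restrict_grading (@H_mem k m) (W_homog (@std_wt (m + m))))
    & forall m : nat, (1 <= m)%N ->
        zgraded_well_covered (L := W k (m + m + 1)) (@K_mem k m)
          (restrict_grading (@K_mem k m) (W_homog (@K_wt m)))].
Proof.
split.
- exact: vir_well_covered.
- by move=> n _; apply: W_well_covered.
- by move=> n n_gt0; apply: S_well_covered.
- by move=> m _; apply: H_well_covered.
by move=> m _; apply: K_well_covered.
Qed.
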